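(* Let $k$ be a field. Let $\Psi:\mathbf{Sh}\to\mathbf{QSh}$ be the linear map defined on permutations by $\Psi(\sigma)=\sum_{\tau\le\sigma}\tau$ (sum over packed words $\tau\le\sigma$). Then $\Psi$ is a bidendriform bialgebra morphism from $(\mathbf{Sh},\prec,\succ,\Delta_\prec,\Delta_\succ)$ to $(\mathbf{QSh},\preceq,\succ,\Delta_\prec,\Delta_\succ)$, where $\preceq\,:=\,\prec+\bullet$; that is, for nonempty permutations $\sigma,\tau$, $\Psi(\sigma\prec\tau)=\Psi(\sigma)\preceq\Psi(\tau)$, $\Psi(\sigma\succ\tau)=\Psi(\sigma)\succ\Psi(\tau)$, and $\Delta_\prec\circ\Psi=(\Psi\otimes\Psi)\circ\Delta_\prec$, $\Delta_\succ\circ\Psi=(\Psi\otimes\Psi)\circ\Delta_\succ$. Moreover $\Psi\circ\Omega'=\Omega\circ\psi$ as maps $\mathbf{PBT}\to\mathbf{QSh}$.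
   Context: Words: a packed word of length $n$ is a word $\sigma$ of positive integers with set of letters $\{1,\dots,\max\sigma\}$, viewed as a map $[n]\to[\max\sigma]$; $\mathbb{S}\mathrm{urj}_n$ is the set of packed words of length $n$, $\mathfrak S_n$ the subset of permutations. $Pack(u)$ is the packed word with the same relative order (and equalities) of letters as $u$; $\sigma_{|I}$ is the subword of letters belonging to $I$. $\mathbf{QSh}$ (resp. $\mathbf{Sh}$) is the span of nonempty packed words (resp. permutations). For packed words $\sigma,\tau$ with $a=\max\sigma$, $b=\max\tau$, let $\sigma\otimes\tau$ be $\sigma$ followed by $\tau$ with letters increased by $a$, and let $QSh_{a,b}$ be the set of $\zeta\in\mathbb{S}\mathrm{urj}_{a+b}$ increasing (strictly) on $\{1,\dots,a\}$ and on $\{a+1,\dots,a+b\}$. In $\mathbf{QSh}$, $\sigma\prec\tau$ (resp. $\succ$, $\bullet$) is $\sum\zeta\circ(\sigma\otimes\tau)$ over $\zeta\in QSh_{a,b}$ with $\zeta^{-1}(1)=\{1\}$ (resp. $\{a+1\}$, $\{1,a+1\}$). In $\mathbf{Sh}$, $\sigma\prec\tau$ (resp. $\succ$) is the same sum restricted to $\zeta\in QSh_{a,b}\cap\mathfrak S_{a+b}$ with $\zeta(1)=1$ (resp. $\zeta(a+1)=1$). On both, $\Delta_\prec(\sigma)=\sum_{i=\sigma(1)}^{\max\sigma-1}\sigma_{|\{1,\dots,i\}}\otimes Pack(\sigma_{|\{i+1,\dots,\max\sigma\}})$ and $\Delta_\succ(\sigma)=\sum_{i=1}^{\sigma(1)-1}\sigma_{|\{1,\dots,i\}}\otimes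 Pack(\sigma_{|\{i+1,\dots,\max\sigma\}})$. Order on packed words of the same length $n$: $\sigma\le\tau$ if (1) for all $i,j\in[n]$, $\tau(i)\le\tau(j)$ implies $\sigma(i)\le\sigma(j)$; and (2) for all $i<j$ in $[n]$, $\tau(i)>\tau(j)$ implies $\sigma(i)>\sigma(j)$. Trees: a Schröder tree is a planar rooted tree in which every internal vertex has at least two children, of degree (number of leaves) $-1$; $|$ is the tree of degree $0$; $t_1\vee\cdots\vee t_m$ is obtained by grafting $t_1,\dots,t_m$ from left to right on a common root. $\mathbf{ST}$ (resp. $\mathbf{PBT}$) is the span of Schröder trees (resp. planar binary trees) of degree $\ge1$. $\varrho(\text{empty word})=|$ and, if $\sigma=u_1\,1\,u_2\,1\cdots1\,u_{q+1}$ where the $u_i$ do not contain the letter $1$, $\varrho(\sigma)=\varrho(Pack(u_1))\vee\cdots\vee\varrho(Pack(u_{q+1}))$. $\Omega:\mathbf{ST}\to\mathbf{QSh}$, $\Omega(t)=\sum_{\sigma\text{ packed word},\,\varrho(\sigma)=t}\sigma$; $\Omega':\mathbf{PBT}\to\mathbf{Sh}$, $\Omega'(t)=\sum_{\sigma\text{ permutation},\,\varrho(\sigma)=t}\sigma$. $\psi:\mathbf{PBT}\to\mathbf{ST}$, $\psi(t)=\sum_{t'\le t}t'$, where $t'\le t$ means that $t'$ is obtained from $t$ by contracting a set of edges $e$ of $t$ each of which joins two internal vertices and is the rightmost edge going up from its lower vertex. *)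

(* Defs.v *)
From HB Require Import structures.
From mathcomp Require Import all_boot all_algebra.
From mathcomp Require Export freeg.

Set Implicit Arguments.
Unset Strict Implicit.
Unset Printing Implicit Defensive.

Import GRing.Theory.

(** * Words *)

Notation word := (seq nat).

Definition maxl (w : word) : nat := foldr maxn 0 w.

(** Positions are numbered from 1, as in the view of a word as a map from
    [n] = {1, ..., n}; the value [letter w 0] is never used. *)
Definition letter (w : word) (i : nat) : nat := nth 0 w i.-1.

Definition packed (w : word) : bool :=
  (0 \notin w) && all [in w] (iota 1 (maxl w)).

Definition is_perm (w : word) : bool := perm_eq w (iota 1 (size w)).

Definition packed_word : pred word := [pred w | (w != [::]) && packed w].
Definition perm_word : pred word := [pred w | (w != [::]) && is_perm w].

Fixpoint words (m n : nat) : seq word :=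
  if n is n'.+1 then [seq x :: w | x <- iota 1 m, w <- words m n'] else [:: [::]].

(** The packed words of length [n], without repetition (see [mem_surj] and
    [surj_uniq]); all their letters are in {1, ..., n}. *)
Definition surj (n : nat) : seq word := [seq w <- words n n | packed w].

(** The rank of [x] among the distinct letters of [w]. *)
Definition rank (w : word) (x : nat) : nat := size (undup [seq y <- w | y <= x]).
Definition pack (w : word) : word := [seq rank w x | x <- w].

Definition restr (w : word) (I : seq nat) : word := [seq x <- w | x \in I].

Definition catshift (s t : word) : word := s ++ [seq maxl s + x | x <- t].

Definition comp (z w : word) : word := [seq letter z x | x <- w].

Definition qsh (a b : nat) : seq word :=
  [seq z <- surj (a + b) | sorted ltn (take a z) && sorted ltn (drop a z)].

Definition preim1 (z : word) : seq nat :=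
  [seq i <- iota 1 (size z) | letter z i == 1].

Definition word_le (s t : word) : bool :=
  [&& size s == size t,
      all (fun i => all (fun j =>
        (letter t i <= letter t j) ==> (letter s i <= letter s j))
        (iota 1 (size t))) (iota 1 (size t)) &
      all (fun i => all (fun j =>
        (i < j) && (letter t i > letter t j) ==> (letter s i > letter s j))
        (iota 1 (size t))) (iota 1 (size t))].

Lemma maxl_leq w m : (maxl w <= m) = all (fun x => x <= m) w.
Proof. by elim: w => //= x w <-; rewrite geq_max. Qed.

Lemma mem_packed w : packed w -> w =i iota 1 (maxl w).
Proof.
case/andP=> w0 /allP w1 x; rewrite mem_iota add1n ltnS; apply/idP/idP => [xw|].
  have := leqnn (maxl w); rewrite maxl_leq => /allP /(_ x xw) ->.
  by rewrite andbT lt0n; apply: contraNneq w0 => <-.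
by move=> lex; apply: w1; rewrite mem_iota add1n ltnS.
Qed.

Lemma packed_mem w m : w =i iota 1 m -> packed w /\ maxl w = m.
Proof.
move=> wE; have mE : maxl w = m.
  apply/eqP; rewrite eqn_leq maxl_leq; apply/andP; split.
    by apply/allP => x; rewrite wE mem_iota add1n ltnS => /andP[].
  case: m wE => // m wE; have := leqnn (maxl w); rewrite maxl_leq => /allP; apply.
  by rewrite wE mem_iota add1n ltnS /= leqnn.
by split=> //; rewrite /packed wE mem_iota /= mE; apply/allP => x /=; rewrite wE.
Qed.

Lemma maxl_packed_size w : packed w -> maxl w <= size w.
Proof.
move=> /mem_packed wE; rewrite -[X in X <= _](size_iota 1).
by apply: uniq_leq_size => [|x]; rewrite ?iota_uniq // wE.
Qed.

Lemma mem_words m n w :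
  (w \in words m n) = (size w == n) && all (fun x => 0 < x <= m) w.
Proof.
elim: n w => [|n IH] w /=; first by rewrite inE; case: w.
apply/allpairsP/idP => [[[x u] /= [xm /[!IH]/andP[/eqP su au] ->]]|].
  by rewrite /= su eqxx au andbT; move: xm; rewrite mem_iota add1n ltnS.
case: w => [|x u] //= /andP[su /andP[xm au]]; exists (x, u).
by rewrite IH au mem_iota add1n ltnS -eqSS su.
Qed.

Lemma mem_surj n w : (w \in surj n) = packed w && (size w == n).
Proof.
rewrite mem_filter mem_words; case: (boolP (packed w)) => //= pw.
case: eqP => //= <-; apply/allP => x.
rewrite (mem_packed pw) mem_iota add1n ltnS => /andP[-> lex] /=.
exact: leq_trans (maxl_packed_size pw).
Qed.

Lemma surj_uniq n : uniq (surj n).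
Proof.
apply: filter_uniq; elim: {2}n => //= m IH.
by apply: allpairs_uniq => //; [exact: iota_uniq | case=> a b [c d] _ _ [-> ->]].
Qed.

Lemma is_permE w : is_perm w = packed w && uniq w.
Proof.
apply/idP/andP => [wP|[pw uw]].
  have wE := perm_mem wP; rewrite (perm_uniq wP) iota_uniq.
  by have [] := packed_mem wE.
have wE := mem_packed pw.
suff sE : size w = maxl w by apply: uniq_perm; rewrite ?iota_uniq // sE.
rewrite -[RHS](size_iota 1); apply/eqP; rewrite eq_sym.
by rewrite -(uniq_size_uniq uw) ?iota_uniq.
Qed.

Lemma perm_word_packed w : perm_word w -> packed_word w.
Proof. by case/andP=> w0; rewrite is_permE => /andP[pw _]; apply/andP. Qed.

Lemma is_perm_maxl w : is_perm w -> maxl w = size w.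
Proof. by move/perm_mem/packed_mem => []. Qed.

Lemma map_letter w : [seq letter w i | i <- iota 1 (size w)] = w.
Proof.
apply: (@eq_from_nth _ 0) => [|i]; rewrite size_map size_iota // => lti.
by rewrite (nth_map 0) ?size_iota // nth_iota.
Qed.

Lemma mem_catshift s t : packed s -> packed t ->
  catshift s t =i iota 1 (maxl s + maxl t).
Proof.
move=> /mem_packed sE /mem_packed tE x.
rewrite mem_cat sE iotaD mem_cat; congr (_ || _).
rewrite addnC iotaDl; apply/mapP/mapP => -[y yt ->]; exists y => //.
  by rewrite -tE.
by rewrite tE.
Qed.

Lemma mem_qsh_surj a b z : z \in qsh a b -> z \in surj (a + b).
Proof. by rewrite mem_filter => /andP[]. Qed.

Lemma packed_word_comp s t z : packed_word s -> packed_word t ->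
  z \in qsh (maxl s) (maxl t) -> packed_word (comp z (catshift s t)).
Proof.
case/andP=> s0 ps /andP[_ pt] /mem_qsh_surj; rewrite mem_surj => /andP[pz /eqP sz].
apply/andP; split; first by case: s s0 {ps sz}.
have [] // := @packed_mem (comp z (catshift s t)) (maxl z).
move=> x; rewrite -mem_packed // -[in RHS](map_letter z) sz.
exact/eq_mem_map/mem_catshift.
Qed.

Lemma perm_word_comp s t z : perm_word s -> perm_word t ->
  z \in qsh (maxl s) (maxl t) -> is_perm z -> perm_word (comp z (catshift s t)).
Proof.
move=> sP tP zq zP.
have /andP[cn0 _] := packed_word_comp (perm_word_packed sP) (perm_word_packed tP) zq.
apply/andP; split=> //; case/andP: sP => _ sP; case/andP: tP => _ tP.
have := mem_qsh_surj zq; rewrite mem_surj => /andP[_ /eqP sz].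
rewrite /is_perm size_map size_cat size_map -!is_perm_maxl // -sz.
apply: perm_trans zP; rewrite -[X in perm_eq _ X](map_letter z) sz perm_map //.
rewrite iotaD (is_perm_maxl sP) perm_cat // addnC iotaDl.
by rewrite (is_perm_maxl tP) (is_perm_maxl sP) perm_map.
Qed.

Lemma rank_lt w x y : y \in w -> x < y -> rank w x < rank w y.
Proof.
move=> yw ltxy; rewrite /rank.
have: uniq (y :: undup [seq z <- w | z <= x]).
  by rewrite /= undup_uniq mem_undup mem_filter leqNgt ltxy.
move/uniq_leq_size; apply => z; rewrite inE !mem_undup !mem_filter.
case/predU1P => [->|/andP[lez ->]]; first by rewrite leqnn.
by rewrite (leq_trans lez (ltnW ltxy)).
Qed.

Lemma rank_inj w : {in w &, injective (rank w)}.
Proof.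
move=> x y xw yw; case: (ltngtP x y) => // lt E.
  by have := rank_lt yw lt; rewrite E ltnn.
by have := rank_lt xw lt; rewrite E ltnn.
Qed.

Lemma mem_pack w : pack w =i iota 1 (size (undup w)).
Proof.
have sub : {subset map (rank w) (undup w) <= iota 1 (size (undup w))}.
  move=> _ /mapP[x + ->]; rewrite mem_undup mem_iota add1n ltnS => xw.
  apply/andP; split.
    by rewrite lt0n size_eq0; apply/eqP/nilP; rewrite /nilp -lt0n -has_predT;
       apply/hasP; exists x; rewrite // mem_undup mem_filter leqnn.
  apply: uniq_leq_size => [|z]; first exact: undup_uniq.
  by rewrite !mem_undup mem_filter => /andP[].
have u : uniq (map (rank w) (undup w)).
  rewrite map_inj_in_uniq ?undup_uniq // => x y.
  by rewrite !mem_undup; exact: rank_inj.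
have [|_ E] := uniq_min_size u sub; first by rewrite size_map size_iota.
move=> x; rewrite -E; apply: (@eq_mem_map _ _ (rank w)) => y.
by rewrite mem_undup.
Qed.

Lemma packed_pack w : packed (pack w).
Proof. by have [] := packed_mem (mem_pack w). Qed.

Lemma size_pack w : size (pack w) = size w.
Proof. exact: size_map. Qed.

Lemma packed_word_cut s i : packed_word s -> 0 < i < maxl s ->
  packed_word (restr s (index_iota 1 i.+1)) /\
  packed_word (pack (restr s (index_iota i.+1 (maxl s).+1))).
Proof.
case/andP=> s0 ps /andP[i0 ilt]; have sE := mem_packed ps; split.
  have [] := @packed_mem (restr s (index_iota 1 i.+1)) i => [x|pr E].
    rewrite mem_filter sE mem_index_iota !mem_iota !add1n !ltnS.
    by case: (0 < x) => //=; apply/andb_idr => /leq_trans; apply; exact: ltnW.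
  by apply/andP; split=> //; apply: contraTneq i0 => r0; rewrite -E r0.
rewrite /packed_word /= packed_pack andbT -size_eq0 size_pack size_eq0 -has_filter.
apply/hasP; exists (maxl s); last by rewrite mem_index_iota ilt /=.
by rewrite sE mem_iota add1n ltnS leqnn (leq_ltn_trans _ ilt).
Qed.

Lemma perm_word_cut s i : perm_word s -> 0 < i < maxl s ->
  perm_word (restr s (index_iota 1 i.+1)) /\
  perm_word (pack (restr s (index_iota i.+1 (maxl s).+1))).
Proof.
move=> sP ib; have [/andP[l0 lP] /andP[r0 rP]] :=
  packed_word_cut (perm_word_packed sP) ib.
have us : uniq s by case/andP: sP => _; rewrite is_permE => /andP[].
rewrite /perm_word /= l0 r0 !is_permE lP rP filter_uniq //; split=> //=.
by rewrite map_inj_in_uniq ?filter_uniq //; exact: rank_inj.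
Qed.

Lemma surj_packed_word n w : 0 < n -> w \in surj n -> packed_word w.
Proof.
move=> n0; rewrite mem_surj => /andP[pw /eqP sw].
by rewrite /packed_word /= pw andbT -size_eq0 sw -lt0n.
Qed.

Lemma word_le_packed_word s t : perm_word s -> t \in surj (size s) -> packed_word t.
Proof. by case/andP=> s0 _; apply: surj_packed_word; rewrite lt0n size_eq0.
Qed.

(** * Trees *)

(** Planar rooted trees; the leaves are the vertices without children. *)
Inductive ptree : Type := Node of seq ptree.

Definition leaf : ptree := Node [::].
Definition children (t : ptree) : seq ptree := let: Node ts := t in ts.
Definition internal (t : ptree) : bool := ~~ nilp (children t).

Lemma ptree_nested_ind (P : ptree -> Prop) :
  (forall ts, (forall i, i < size ts -> P (nth leaf ts i)) -> P (Node ts)) ->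
  forall t, P t.
Proof.
move=> IH; fix rec 1 => -[ts]; apply: IH.
elim: ts => [|t ts IHts].
  by move=> i lti; discriminate lti.
by case=> [_|i lti]; [exact: rec | exact: IHts lti].
Qed.

Fixpoint ptree_encode (t : ptree) : GenTree.tree unit :=
  let: Node ts := t in GenTree.Node 0 (map ptree_encode ts).
Fixpoint ptree_decode (t : GenTree.tree unit) : ptree :=
  if t is GenTree.Node _ ts then Node (map ptree_decode ts) else leaf.

Lemma ptree_encodeK : cancel ptree_encode ptree_decode.
Proof.
elim/ptree_nested_ind => ts IH /=; congr Node; rewrite -map_comp.
apply: (@eq_from_nth _ leaf) => [|i]; rewrite size_map // => lti.
by rewrite (nth_map leaf) //= IH.
Qed.

HB.instance Definition _ := Choice.copy ptree (can_type ptree_encodeK).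

Fixpoint leaves (t : ptree) : nat :=
  let: Node ts := t in if ts is [::] then 1 else sumn (map leaves ts).
Definition degree (t : ptree) : nat := (leaves t).-1.

Fixpoint schroder (t : ptree) : bool :=
  let: Node ts := t in (size ts != 1) && all schroder ts.
Fixpoint binary (t : ptree) : bool :=
  let: Node ts := t in (size ts \in [:: 0; 2]) && all binary ts.

Definition schroder_tree : pred ptree :=
  [pred t | schroder t && (1 <= degree t)].
Definition binary_tree : pred ptree := [pred t | binary t && (1 <= degree t)].

(** [split1 (u_1 1 u_2 1 ... 1 u_(q+1)) = [:: u_1; ...; u_(q+1)]] *)
Fixpoint split1 (w : word) : seq word :=
  if w is x :: w' then
    if x == 1 then [::] :: split1 w'
    else (x :: head [::] (split1 w')) :: behead (split1 w')
  else [:: [::]].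

(** The first argument bounds the recursion depth: every subword cut out of a
    nonempty packed word is shorter than it, so [size w] is enough (see
    [rho_split] below). *)
Fixpoint rho_rec (n : nat) (w : word) : ptree :=
  if w is [::] then leaf else
  if n is n'.+1 then Node [seq rho_rec n' (pack u) | u <- split1 w] else leaf.
Definition rho (w : word) : ptree := rho_rec (size w) w.

(** An edge is named by the address of its upper vertex: the list of the
    (0-based) ranks of the successive children on the path from the root. *)

(** Edges joining two internal vertices which are the rightmost edge going up
    from their lower vertex. *)
Fixpoint right_edges (t : ptree) : seq (seq nat) :=
  let: Node ts := t in
  (fix go (i : nat) (ts : seq ptree) : seq (seq nat) :=
     if ts is t1 :: ts' then
       (if nilp ts' && internal t1 then [:: [:: i]] else [::])
         ++ [seq i :: p | p <- right_edges t1] ++ go i.+1 ts'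
     else [::]) 0 ts.

Fixpoint contract (E : pred (seq nat)) (t : ptree) {struct t} : ptree :=
  let: Node ts := t in
  Node ((fix go (i : nat) (ts : seq ptree) : seq ptree :=
     if ts is t1 :: ts' then
       let t1' := contract (fun p => E (i :: p)) t1 in
       (if E [:: i] then children t1' else [:: t1']) ++ go i.+1 ts'
     else [::]) 0 ts).

Fixpoint subsets (T : Type) (s : seq T) : seq (seq T) :=
  if s is x :: s' then [seq x :: e | e <- subsets s'] ++ subsets s'
  else [:: [::]].

Definition below (t : ptree) : seq ptree :=
  undup [seq contract [in E] t | E <- subsets (right_edges t)].

Lemma split1_size w : size (split1 w) = (count_mem 1 w).+1.
Proof.
elim: w => //= x w IH; case: eqP => _ /=; rewrite ?IH //=.
by rewrite size_behead IH.
Qed.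

Lemma sumn_split1 w : sumn [seq (size u).+1 | u <- split1 w] = (size w).+1.
Proof.
elim: w => //= x w IH; case: eqP => _ /=; first by rewrite IH.
by move: IH; have := split1_size w; case: (split1 w) => //= u us _ [<-].
Qed.

Lemma split1_lt w u : 1 \in w -> u \in split1 w -> size u < size w.
Proof.
move=> w1 uw; have {w1} : 0 < count_mem 1 w by rewrite -has_count has_pred1.
move=> w1; rewrite -ltnS -(sumn_split1 w).
have := perm_to_rem uw => up.
rewrite (perm_sumn (perm_map (fun u : word => (size u).+1) up)).
have : size (rem u (split1 w)) = count_mem 1 w by rewrite size_rem // split1_size.
case: (rem u _) => [|v vs] /=; first by move=> E; rewrite -E in w1.
by move=> _; rewrite -[X in X < _]addn0 ltn_add2l.
Qed.

Lemma packed_mem1 w : w != [::] -> packed w -> 1 \in w.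
Proof.
case: w => // x w _ pw; rewrite (mem_packed pw) mem_iota add1n /= ltnS.
have : x \in x :: w by rewrite mem_head.
by rewrite (mem_packed pw) mem_iota add1n ltnS => /andP[/leq_trans]; apply.
Qed.

Lemma rho_rec_stable n w : packed w -> size w <= n -> rho_rec n w = rho w.
Proof.
have aux m : forall p w, packed w -> size w <= m -> size w <= p ->
    rho_rec m w = rho_rec p w.
  elim: m => [|m IH] [|p] [|x {}w] // pw sm sp; rewrite [LHS]/= [RHS]/=.
  congr Node; apply/eq_in_map => u us.
  have lu := @split1_lt (x :: w) u (@packed_mem1 (x :: w) isT pw) us.
  by apply: IH; rewrite ?packed_pack // size_pack -ltnS (leq_trans lu).
by move=> pw sw; apply: aux.
Qed.

Lemma rho_split w : packed_word w ->
  rho w = Node [seq rho (pack u) | u <- split1 w].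
Proof.
case/andP; case: w => // x w _ pw; rewrite [LHS]/=; congr Node.
apply/eq_in_map => u us; apply: rho_rec_stable; first exact: packed_pack.
by rewrite size_pack -ltnS (@split1_lt (x :: w) u (@packed_mem1 (x :: w) isT pw) us).
Qed.

Lemma leaves_rho w : packed w -> leaves (rho w) = (size w).+1.
Proof.
have [n] := ubnP (size w); elim: n w => // n IH w; rewrite ltnS => sw pw.
have [-> //|w0] := eqVneq w [::].
rewrite rho_split; last exact/andP.
rewrite -sumn_split1; have := split1_size w.
case E: (split1 w) => [|u0 us] //= _; rewrite -map_comp.
suff H v : v \in split1 w -> leaves (rho (pack v)) = (size v).+1.
  rewrite H ?E ?mem_head //; congr (_ + sumn _); apply/eq_in_map => v vus /=.
  by rewrite H // E inE vus orbT.
move=> vs; rewrite IH ?packed_pack ?size_pack //.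
exact: leq_trans (split1_lt (packed_mem1 w0 pw) vs) sw.
Qed.

Lemma degree_rho w : packed w -> degree (rho w) = size w.
Proof. by move/leaves_rho; rewrite /degree => ->. Qed.

Fixpoint right_edges_seq (i : nat) (ts : seq ptree) : seq (seq nat) :=
  if ts is t1 :: ts' then
    (if nilp ts' && internal t1 then [:: [:: i]] else [::])
      ++ [seq i :: p | p <- right_edges t1] ++ right_edges_seq i.+1 ts'
  else [::].

Lemma right_edgesE ts : right_edges (Node ts) = right_edges_seq 0 ts.
Proof. by []. Qed.

Definition contract_seq (E : pred (seq nat)) : nat -> seq ptree -> seq ptree :=
  fix go (i : nat) (ts : seq ptree) : seq ptree :=
    if ts is t1 :: ts' then
      let t1' := contract (fun p => E (i :: p)) t1 in
      (if E [:: i] then children t1' else [:: t1']) ++ go i.+1 ts'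
    else [::].

Lemma contractE E ts : contract E (Node ts) = Node (contract_seq E 0 ts).
Proof. by []. Qed.

Lemma right_edges_head j i ts p :
  j :: p \in right_edges_seq i ts -> i <= j.
Proof.
elim: ts i => //= t1 ts IH i; rewrite !mem_cat => /or3P[|/mapP[q _ [-> _]] //|].
  by case: ifP; rewrite ?inE // => _ /eqP[->].
by move/IH/ltnW.
Qed.

Lemma right_edges_nil t : [::] \notin right_edges t.
Proof.
case: t => ts; rewrite right_edgesE; elim: ts 0 => //= t ts IH i.
rewrite !mem_cat !negb_or IH andbT; apply/andP; split; first by case: ifP.
by apply/mapP => -[].
Qed.

Lemma leaves_children t :
  internal t -> leaves t = sumn (map leaves (children t)).
Proof. by case: t => -[]. Qed.

Lemma schroder_children t : schroder t = (size (children t) != 1) && all schroder (children t).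
Proof. by case: t. Qed.

Lemma contract_wf t (E : pred (seq nat)) :
  schroder t -> (forall p, p != [::] -> E p -> p \in right_edges t) ->
  [/\ schroder (contract E t), leaves (contract E t) = leaves t &
      internal (contract E t) = internal t].
Proof.
elim/ptree_nested_ind: t E => ts IH E; rewrite right_edgesE contractE.
rewrite [schroder (Node ts)]/= => /andP[s1 sts] sub.
have {}IH t (E' : pred (seq nat)) : t \in ts -> schroder t ->
    (forall p, p != [::] -> E' p -> p \in right_edges t) ->
    [/\ schroder (contract E' t), leaves (contract E' t) = leaves t &
      internal (contract E' t) = internal t].
  by move=> /(nthP leaf)[i lti <-]; exact: IH.
suff [H1 H2 H3 H4] : [/\ all schroder (contract_seq E 0 ts),
   sumn (map leaves (contract_seq E 0 ts)) = sumn (map leaves ts),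
   size ts <= size (contract_seq E 0 ts) &
   nilp ts -> nilp (contract_seq E 0 ts)].
  rewrite /= H1 andbT /internal; split.
  - case: ts s1 H3 H4 {sts sub IH H1 H2} => [_ _ /(_ isT)/nilP->|t0 [|t1 ts]] //.
    by move=> _ H _; rewrite neq_ltn (leq_trans _ H) ?orbT.
  - case: ts {s1 sts sub IH H1} H2 H3 H4 => [_ _ /(_ isT)/nilP->|t0 ts] //.
    by case: (contract_seq _ _ _).
  - case: ts {s1 sts sub IH H1 H2} H3 H4 => [_ /(_ isT)/nilP->|t0 ts] //.
    by case: (contract_seq _ _ _).
have {}sub j p : E (j :: p) -> 0 <= j -> j :: p \in right_edges_seq 0 ts.
  by move=> Ep _; apply: sub.
move: 0 sub {s1} => i; elim: ts i IH sts => [|t1 ts IHts] i IH //=.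
case/andP=> st1 sts sub.
have [|c1 c2 c3] := IH t1 (fun p => E (i :: p)) (mem_head _ _) st1.
  move=> p p0 /sub /(_ (leqnn i)); rewrite !mem_cat => /or3P[||].
  - by case: ifP; rewrite ?inE // => _ /eqP[] E0; rewrite E0 in p0.
  - by case/mapP=> q qt [->].
  - by move/right_edges_head; rewrite ltnn.
have [||d1 d2 d3 d4] := IHts i.+1 _ sts.
- by move=> t E' tts; apply: IH; rewrite inE tts orbT.
- move=> j p Ep lij; move: (sub j p Ep (ltnW lij)); rewrite !mem_cat => /or3P[||//].
    by case: ifP; rewrite ?inE // => _ /eqP[ij _]; rewrite ij ltnn in lij.
  by case/mapP=> q _ [ij]; rewrite ij ltnn in lij.
rewrite all_cat d1 map_cat sumn_cat d2 size_cat andbT.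
case: ifPn => Ei /=; last by rewrite c1 c2 addn0 add1n ltnS d3.
have it1 : internal t1.
  move: (sub _ _ Ei (leqnn i)); rewrite !mem_cat => /or3P[||].
  - by case: ifP => // /andP[].
  - by case/mapP=> q qt [q0]; move: qt; rewrite -q0 (negPf (right_edges_nil t1)).
  - by move/right_edges_head; rewrite ltnn.
move: c1; rewrite schroder_children => /andP[_ ->]; split=> //.
  by rewrite -leaves_children ?c3 // c2.
have : internal (contract (fun p => E (i :: p)) t1) by rewrite c3.
rewrite /internal; case: (children _) => //= x xs _.
by rewrite addSn ltnS (leq_trans d3) // leq_addl.
Qed.

Lemma mem_subsets (T : eqType) (s e : seq T) x : e \in subsets s -> x \in e -> x \in s.
Proof.
elim: s e => [|y s IH] e /=; first by rewrite inE => /eqP->.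
rewrite mem_cat => /orP[/mapP[f fs ->]|es xe]; rewrite !inE.
  by case/predU1P => [->|/(IH _ fs) ->]; rewrite ?eqxx ?orbT.
by rewrite (IH _ es xe) orbT.
Qed.

Lemma below_schroder t t' : schroder t -> t' \in below t ->
  schroder t' /\ degree t' = degree t.
Proof.
move=> st; rewrite mem_undup => /mapP[E Es ->].
have [p _ pE|s' lE _] := @contract_wf t [in E] st; first exact: mem_subsets pE.
by split=> //; rewrite /degree lE.
Qed.

Lemma binary_schroder t : binary t -> schroder t.
Proof.
elim/ptree_nested_ind: t => ts IH /= /andP[sz /(all_nthP leaf) bts].
apply/andP; split; first by case: (size ts) sz => [|[]].
by apply/(all_nthP leaf) => i lti; apply/IH/bts.
Qed.

Lemma below_schroder_tree t t' : binary_tree t -> t' \in below t -> schroder_tree t'.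
Proof.
case/andP=> /binary_schroder st d1 /(below_schroder st)[s' d'].
by apply/andP; split; rewrite ?d'.
Qed.

(** * Spans and linear extensions *)

Local Open Scope ring_scope.

Notation span k P := {freeg {x | P x} / k}.

(** The free module on pairs of basis elements. *)
Notation span2 k P := {freeg ({x | P x} * {x | P x})%type / k}.

(** The basis vector of [x]; it is 0 if [x] is not in [P], but below it is only
    applied to elements of [P]: see [packed_word_comp], [perm_word_comp],
    [packed_word_cut], [perm_word_cut], [word_le_packed_word],
    [surj_packed_word], [below_schroder_tree]. *)
Definition bvec (k : fieldType) (T : choiceType) (P : pred T) (x : T)
    : span k P :=
  if insub x is Some u then << u >> else 0.

Definition linext (k : fieldType) (T : choiceType) (P : pred T)
    (M : lmodType k) (f : T -> M) : span k P -> M :=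
  fglift (fun u : {x | P x} => f (val u)).

Definition bilinext (k : fieldType) (T : choiceType) (P : pred T)
    (M : lmodType k) (f : T -> T -> M) (x y : span k P) : M :=
  linext (fun s => linext (f s) y) x.

Definition tensor (k : fieldType) (T : choiceType) (P : pred T)
    (x y : span k P) : span2 k P :=
  fglift (fun u => fglift (fun v => << (u, v) >> : span2 k P) y) x.

Definition tensor_map (k : fieldType) (T : choiceType) (P Q : pred T)
    (f : span k P -> span k Q) : span2 k P -> span2 k Q :=
  fglift (fun uv : {x | P x} * {x | P x} =>
    tensor (f << uv.1 >>) (f << uv.2 >>)).

(** * The bidendriform bialgebras of permutations and packed words *)

Notation Sh k := (span k perm_word).
Notation QSh k := (span k packed_word).

Section Operations.
Context (k : fieldType).

Definition prec_QSh : QSh k -> QSh k -> QSh k :=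
  bilinext (fun s t => \sum_(z <- qsh (maxl s) (maxl t) | preim1 z == [:: 1%N])
    bvec k packed_word (comp z (catshift s t))).

Definition succ_QSh : QSh k -> QSh k -> QSh k :=
  bilinext (fun s t =>
    \sum_(z <- qsh (maxl s) (maxl t) | preim1 z == [:: (maxl s).+1])
      bvec k packed_word (comp z (catshift s t))).

Definition bullet_QSh : QSh k -> QSh k -> QSh k :=
  bilinext (fun s t =>
    \sum_(z <- qsh (maxl s) (maxl t) | preim1 z == [:: 1%N; (maxl s).+1])
      bvec k packed_word (comp z (catshift s t))).

Definition preceq_QSh (x y : QSh k) : QSh k := prec_QSh x y + bullet_QSh x y.

Definition prec_Sh : Sh k -> Sh k -> Sh k :=
  bilinext (fun s t =>
    \sum_(z <- qsh (maxl s) (maxl t) | is_perm z && (letter z 1 == 1%N))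
      bvec k perm_word (comp z (catshift s t))).

Definition succ_Sh : Sh k -> Sh k -> Sh k :=
  bilinext (fun s t =>
    \sum_(z <- qsh (maxl s) (maxl t)
          | is_perm z && (letter z (maxl s).+1 == 1%N))
      bvec k perm_word (comp z (catshift s t))).

Definition cut (P : pred word) (s : word) (i : nat) : span2 k P :=
  tensor (bvec k P (restr s (index_iota 1 i.+1)))
         (bvec k P (pack (restr s (index_iota i.+1 (maxl s).+1)))).

(** Used with [P := perm_word] and [P := packed_word]. *)
Definition Delta_prec (P : pred word) : span k P -> span2 k P :=
  linext (fun s => \sum_(letter s 1 <= i < maxl s) cut P s i).

Definition Delta_succ (P : pred word) : span k P -> span2 k P :=
  linext (fun s => \sum_(1 <= i < letter s 1) cut P s i).

Definition Psi : Sh k -> QSh k :=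
  linext (fun s =>
    \sum_(t <- surj (size s) | word_le t s) bvec k packed_word t).

End Operations.

Arguments Delta_prec k P _ : clear implicits.
Arguments Delta_succ k P _ : clear implicits.

Definition bidendriform_morphism (k : fieldType) (P Q : pred word)
    (precP succP : span k P -> span k P -> span k P)
    (DprecP DsuccP : span k P -> span2 k P)
    (precQ succQ : span k Q -> span k Q -> span k Q)
    (DprecQ DsuccQ : span k Q -> span2 k Q)
    (f : span k P -> span k Q) : Prop :=
  [/\ linear f,
      forall x y, f (precP x y) = precQ (f x) (f y),
      forall x y, f (succP x y) = succQ (f x) (f y),
      forall x, DprecQ (f x) = tensor_map f (DprecP x) &
      forall x, DsuccQ (f x) = tensor_map f (DsuccP x)].

Notation PBT k := (span k binary_tree).
Notation ST k := (span k schroder_tree).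

Section TreeMaps.
Context (k : fieldType).

(** If [rho w = t] then [size w = degree t] (see [degree_rho] below), so the
    sums over all packed words range over those of length [degree t]. *)
Definition Omega : ST k -> QSh k :=
  linext (fun t =>
    \sum_(w <- surj (degree t) | rho w == t) bvec k packed_word w).

Definition Omega' : PBT k -> Sh k :=
  linext (fun t =>
    \sum_(w <- surj (degree t) | is_perm w && (rho w == t)) bvec k perm_word w).

Definition psi : PBT k -> ST k :=
  linext (fun t => \sum_(t' <- below t) bvec k schroder_tree t').

End TreeMaps.

(* Main.v *)
(** A packed word [w] satisfies [w <= s] for a permutation [s] exactly when [s]
    is the standardization of [w], so [Psi s] is the sum of the words with
    standardization [s].  The shuffles z o (u (x) v) are the words whose
    prefix and suffix pack to [u] and [v]; standardization commutes with taking
    prefixes and suffixes and preserves the side on which the leftmost [1]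
    occurs, which turns [prec] into [prec + bullet].  For the coproducts, a word
    [w] cut at level [i] amounts to [std w] cut at the number of letters of [w]
    that are at most [i].  On trees, [rho (std w)] is [rho w] with every vertex
    replaced by a right comb, and [t' <= t] says that this binarization sends
    [t'] to [t]. *)

From mathcomp Require Import all_boot all_algebra zify.
Require Import Defs.

Set Implicit Arguments.
Unset Strict Implicit.
Unset Printing Implicit Defensive.

Import GRing.Theory.

(** Standardization is handled through the relation [std_rel], a condition on each pair of positions
    of two words. Such a condition survives restriction to any set of positions and order-preserving
    relabelling, and it determines a word with distinct letters up to packing. Commuting with
    prefixes, suffixes, letter cuts and the splitting at [1] therefore needs no formula for [std].

    For the products, summing over [u] and [v] in two fibres of [std] the words whose prefix and
    suffix pack to [u] and [v] meets each word once. The coproducts are more delicate: a single [w]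
    need not have a cut for every cut of [s], since equal letters cannot be separated. The terms
    match only over the whole fibre of [s], where the two halves of a cut, together with [s],
    determine both the word and the level. *)

Lemma rank_mono w : {in w &, {mono rank w : x y / x <= y}}.
Proof.
move=> x y xw yw; apply/idP/idP => [|lexy].
  by apply: contraTT; rewrite -!ltnNge; exact: rank_lt.
by case: (ltngtP x y) lexy => // [/(rank_lt yw)/ltnW|->].
Qed.

Lemma mem_zip_pair (w v : word) p : p \in zip w v -> p.1 \in w /\ p.2 \in v.
Proof.
elim: w v => [|x w IH] [|y v] //; rewrite !inE.
by case/predU1P=> [->|/IH[-> ->]]; rewrite ?eqxx ?orbT.
Qed.

Lemma zip_map2 (f g : nat -> nat) w v :
  zip (map f w) (map g v) = [seq (f p.1, g p.2) | p <- zip w v].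
Proof. by elim: w v => [|x w IH] [|y v] //=; rewrite IH. Qed.

Lemma pack_map f w :
  {in w &, {mono f : x y / x <= y}} -> pack (map f w) = pack w.
Proof.
move=> fM; rewrite /pack -map_comp; apply/eq_in_map => x xw /=.
have fI : {in w &, injective f}.
  by move=> a b aw bw E; apply/eqP; rewrite eqn_leq -(fM a) // -(fM b) // E leqnn.
rewrite /rank -[RHS](size_map f); apply/perm_size/uniq_perm; rewrite ?undup_uniq //.
  rewrite map_inj_in_uniq ?undup_uniq // => a b.
  by rewrite !mem_undup !mem_filter => /andP[_ aw] /andP[_ bw]; exact: fI.
move=> y; rewrite mem_undup filter_map; apply/mapP/mapP => -[z zw ->]; exists z => //.
  move: zw; rewrite mem_undup !mem_filter => /andP[zw1 zw]; move: zw1 => /=.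
  by rewrite fM // zw andbT => ->.
move: zw; rewrite mem_undup !mem_filter => /andP[zw1 zw].
by rewrite zw /= fM ?zw1.
Qed.

Lemma pack_packed w : packed w -> pack w = w.
Proof.
move=> pw; rewrite /pack -[RHS]map_id; apply/eq_in_map => x xw.
rewrite /rank -[RHS](size_iota 1); apply: perm_size; apply: uniq_perm.
- exact: undup_uniq.
- exact: iota_uniq.
move=> y; rewrite mem_undup mem_filter !(mem_packed pw) !mem_iota !add1n !ltnS.
move: xw; rewrite (mem_packed pw) mem_iota add1n ltnS => /andP[_ xm].
by lia.
Qed.

Lemma pack_pack_map w u : {subset u <= w} -> pack (map (rank w) u) = pack u.
Proof.
by move=> s; apply: pack_map => x y /s xw /s yw; exact: rank_mono.
Qed.

Lemma uniq_pack w : uniq (pack w) = uniq w.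
Proof. exact/map_inj_in_uniq/rank_inj. Qed.

(** * Standardization *)

(** [p] is the earlier position and [q] the later one, each carrying its letter of [w] and its
    letter of [v]. Equal letters of [w] thus become increasing letters of [v]. *)
Definition std_pair (p q : nat * nat) : bool := (p.2 < q.2) == (p.1 <= q.1).

Definition std_rel (w v : word) : bool :=
  (size w == size v) && pairwise std_pair (zip w v).

Lemma std_rel_map f g w v :
    {in w &, {mono f : x y / x <= y}} -> {in v &, {mono g : x y / x <= y}} ->
  std_rel (map f w) (map g v) = std_rel w v.
Proof.
move=> fM gM; rewrite /std_rel !size_map zip_map2 pairwise_map; congr (_ && _).
apply: (@eq_in_pairwise _ [in zip w v]); last exact/allP.
move=> p q /mem_zip_pair[p1 p2] /mem_zip_pair[q1 q2].
by rewrite /std_pair /= fM // !ltnNge gM.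
Qed.

Lemma std_rel_pack w v : std_rel (pack w) v = std_rel w v.
Proof.
rewrite -[in LHS](map_id v); apply: std_rel_map => //; exact: rank_mono.
Qed.

Lemma std_rel_packr w v : std_rel w (pack v) = std_rel w v.
Proof.
rewrite -[in LHS](map_id w); apply: std_rel_map => //; exact: rank_mono.
Qed.

Lemma std_rel_cat w1 w2 v1 v2 : size w1 = size v1 ->
  std_rel (w1 ++ w2) (v1 ++ v2) ->
  [/\ std_rel w1 v1, std_rel w2 v2 & allrel std_pair (zip w1 v1) (zip w2 v2)].
Proof.
move=> s1; rewrite /std_rel !size_cat s1 eqn_add2l zip_cat // pairwise_cat.
by case/and4P => -> -> -> ->; rewrite eqxx.
Qed.

Lemma std_relP w v : reflect
  (size w = size v /\ forall i j, i < j < size w ->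
     (nth 0 v i < nth 0 v j) = (nth 0 w i <= nth 0 w j)) (std_rel w v).
Proof.
apply: (iffP andP) => -[/eqP sE].
  move/(pairwiseP (0, 0)) => H; split=> // i j /andP[lij lj].
  have := H i j; rewrite !inE size_zip -sE minnn lj (ltn_trans lij) // => /(_ isT isT lij).
  by rewrite !nth_zip // => /eqP.
move=> H; rewrite sE; split=> //; apply/(pairwiseP (0, 0)) => i j.
rewrite !inE size_zip -(eqP sE) minnn => li lj lij; rewrite !nth_zip ?(eqP sE) //.
by apply/eqP/H; rewrite lij.
Qed.

Lemma pack_uniqE v : uniq v -> pack v =
  mkseq (fun i => count (fun j => nth 0 v j <= nth 0 v i) (iota 0 (size v))) (size v).
Proof.
move=> uv; rewrite /pack -{2}(mkseq_nth 0 v) /mkseq -map_comp; apply/eq_in_map => i _ /=.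
rewrite /rank undup_id ?filter_uniq // size_filter.
by move: (nth 0 v i) => c; rewrite -[in LHS](mkseq_nth 0 v) /mkseq count_map.
Qed.

(** [w] decides how any two letters of [v] compare, and a packed letter only counts the positions
    carrying a letter at most as large. *)
Lemma std_rel_pack_eq w v v' : uniq v -> uniq v' -> std_rel w v -> std_rel w v' ->
  pack v = pack v'.
Proof.
move=> uv uv' /std_relP[s H] /std_relP[s' H'].
rewrite !pack_uniqE // -s -s' /mkseq; apply/eq_in_map => i; rewrite mem_iota /= => li.
apply: eq_in_count => j; rewrite mem_iota /= => lj; case: (ltngtP i j) => [lij|lji|->].
- by rewrite leqNgt H ?lij // [RHS]leqNgt H' ?lij.
- rewrite leq_eqVlt H ?lji // [RHS]leq_eqVlt H' ?lji // !nth_uniq -?s -?s' //.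
- by rewrite !leqnn.
Qed.

(* Ties between equal letters are broken from left to right. *)
Definition std (w : word) : word :=
  pack [seq nth 0 w i * size w + i | i <- iota 0 (size w)].

(** Each entry of [e] is a two-digit number in base [size w], with the letter as leading digit and
    the position as last digit. Comparison is lexicographic, and the position is recovered as a
    remainder. *)
Lemma std_enc w (e := [seq nth 0 w i * size w + i | i <- iota 0 (size w)]) :
  uniq e /\ std_rel w e.
Proof.
have H : std_rel w e.
  apply/std_relP; rewrite size_map size_iota; split=> // i j /andP[lij lj].
  have li := ltn_trans lij lj.
  rewrite !(nth_map 0) ?size_iota // !nth_iota // !add0n.
  by apply/idP/idP; nia.
split=> //; rewrite map_inj_in_uniq ?iota_uniq // => i j.
rewrite !mem_iota !add0n /= => li lj E.
by have := congr1 (modn^~ (size w)) E; rewrite !modnMDl !modn_small.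
Qed.

Lemma size_std w : size (std w) = size w.
Proof. by rewrite size_pack size_map size_iota. Qed.

Lemma std_perm w : is_perm (std w).
Proof.
by rewrite is_permE packed_pack uniq_pack; have [->] := std_enc w.
Qed.

Lemma std_uniq w : uniq (std w).
Proof. by have := std_perm w; rewrite is_permE => /andP[]. Qed.

Lemma std_relE w : std_rel w (std w).
Proof. by rewrite std_rel_packr; have [] := std_enc w. Qed.

Lemma std_rel_std w v : uniq v -> std_rel w v -> pack v = std w.
Proof.
by move=> uv H; have [ue He] := std_enc w; exact: std_rel_pack_eq H He.
Qed.

Lemma std_relEq w v : is_perm v -> std_rel w v = (std w == v).
Proof.
rewrite is_permE => /andP[pv uv]; apply/idP/eqP => [|<-]; last exact: std_relE.
by move/(std_rel_std uv); rewrite pack_packed.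
Qed.

Lemma std_pack w : std (pack w) = std w.
Proof. by apply/eqP; rewrite -std_relEq ?std_perm // std_rel_pack std_relE. Qed.

(** For positions [i < j], condition (1) is one implication of [std_pair] and condition (2) is the
    contrapositive of the other; distinct letters in [s] turn weak inequalities into strict ones.
    Condition (1) for [j < i] follows by negating [std_pair]. *)
Lemma word_leE w s : is_perm s -> word_le w s = (size w == size s) && (std w == s).
Proof.
move=> sP; rewrite -std_relEq //; have us : uniq s by move: sP; rewrite is_permE => /andP[].
rewrite /word_le; case: eqP => //= sE; apply/andP/std_relP => [[/allP H1 /allP H2]|[_ H]].
  split=> // i j /andP[lij lj]; have li := ltn_trans lij lj.
  have iI k : k < size w -> k.+1 \in iota 1 (size s).
    by rewrite mem_iota add1n ltnS -sE.
  have /allP/(_ _ (iI _ lj))/implyP h1 := H1 _ (iI _ li).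
  have /allP/(_ _ (iI _ lj))/implyP := H2 _ (iI _ li).
  rewrite ltnS lij /= /letter /= in h1 * => h2; apply/idP/idP => [/ltnW//|].
  have: nth 0 s i != nth 0 s j by rewrite nth_uniq -?sE // neq_ltn lij.
  by case: ltngtP h2 => // _ /(_ isT); rewrite ltnNge => /negP.
have inE' k : k \in iota 1 (size s) -> k.-1 < size w /\ 0 < k.
  by rewrite mem_iota add1n ltnS -sE => /andP[k0 lk]; rewrite prednK.
split; apply/allP => i /inE'[li i0]; apply/allP => j /inE'[lj j0];
  apply/implyP; rewrite /letter.
  case: (ltngtP i j) => [lij|lji|-> //].
    rewrite leq_eqVlt nth_uniq -?sE // H; last lia.
    by case/predU1P => // E; move: lij i0 j0 E; lia.
  by rewrite leqNgt H; [rewrite -ltnNge => /ltnW | lia].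
case/andP=> lij; rewrite !ltnNge -H; last lia.
by apply: contra => /ltnW.
Qed.

Lemma mem_zipl (w v : word) x : size w = size v -> x \in w ->
  exists2 y, y \in v & (x, y) \in zip w v.
Proof.
elim: w v => [|a w IH] [|b v] //= [s]; rewrite inE => /predU1P[->|/(IH _ s)[y yv H]].
  by exists b; rewrite ?mem_head.
by exists y; rewrite inE ?yv ?H orbT.
Qed.

Lemma mem_zipr (w v : word) y : size w = size v -> y \in v ->
  exists2 x, x \in w & (x, y) \in zip w v.
Proof.
elim: w v => [|a w IH] [|b v] //= [s]; rewrite inE => /predU1P[->|/(IH _ s)[x xw H]].
  by exists a; rewrite ?mem_head.
by exists x; rewrite inE ?xw ?H orbT.
Qed.

(** * Standardization and trees *)

Lemma split1_notin u : 1 \notin u -> split1 u = [:: u].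
Proof.
elim: u => //= x u IH; rewrite inE negb_or eq_sym => /andP[/negPf-> /IH->] //.
Qed.

Lemma split1_cat u w : 1 \notin u -> split1 (u ++ 1 :: w) = u :: split1 w.
Proof.
elim: u => //= x u IH; rewrite inE negb_or eq_sym => /andP[/negPf-> /IH->] //.
Qed.

Lemma split1_map f w : {in w, forall x, (f x == 1) = (x == 1)} ->
  split1 (map f w) = map (map f) (split1 w).
Proof.
elim: w => //= x w IH H; rewrite (H _ (mem_head _ _)) IH; last first.
  by move=> y yw; apply: H; rewrite inE yw orbT.
by case: eqP => // _; have := split1_size w; case: (split1 w).
Qed.

Lemma split1_sub w u : u \in split1 w -> {subset u <= w}.
Proof.
elim: w u => [|x w IH] u /=; first by rewrite inE => /eqP->.
case: eqP => _; rewrite inE => /predU1P[->|us] //.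
- by move=> y yu; rewrite inE (IH u) ?orbT.
- have := split1_size w; case E: (split1 w) => [|u0 us] //= _ y.
  by rewrite !inE => /predU1P[->|yu]; rewrite ?eqxx // (IH u0) ?orbT // E mem_head.
- by move=> y yu; rewrite inE (IH u) ?orbT //; exact: mem_behead.
Qed.

Lemma rank1 w : 0 \notin w -> 1 \in w -> rank w 1 = 1.
Proof.
move=> w0 w1; have /andP[p0 _] := packed_pack w.
have /mapP[x xw x1] : 1 \in pack w.
  by apply: packed_mem1 (packed_pack w); rewrite -size_eq0 size_pack; case: (w) w1.
case: (ltngtP 1 x) => [lt|lt|E]; last by rewrite [in LHS]E -x1.
  have := rank_lt xw lt; rewrite -x1 ltnS leqn0 => /eqP r0.
  by case/negP: p0; rewrite -r0; exact: map_f.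
by case/negP: w0; move: xw lt; rewrite ltnS leqn0 => + /eqP <-.
Qed.

Lemma split1_pack w : 0 \notin w -> 1 \in w ->
  split1 (pack w) = map (map (rank w)) (split1 w).
Proof.
move=> w0 w1; apply: split1_map => x xw; rewrite -{1}(rank1 w0 w1).
by apply/eqP/eqP => [/rank_inj->|->].
Qed.

Lemma schroder_rho w : packed w -> schroder (rho w).
Proof.
have [n] := ubnP (size w); elim: n w => // n IH w; rewrite ltnS => sw pw.
have [-> //|w0] := eqVneq w [::]; have w1 := packed_mem1 w0 pw.
rewrite rho_split /=; last exact/andP.
rewrite size_map split1_size eqSS -lt0n -has_count has_pred1 w1 /=.
apply/allP => _ /mapP[u us ->]; apply: IH; rewrite ?packed_pack // size_pack.
exact: leq_trans (split1_lt w1 us) sw.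
Qed.

(** * Right-comb binarization of Schröder trees *)

Fixpoint rcomb (ts : seq ptree) : ptree :=
  if ts is t :: ts' then if ts' is [::] then t else Node [:: t; rcomb ts'] else leaf.

Fixpoint rbin (t : ptree) : ptree := let: Node ts := t in rcomb (map rbin ts).

Lemma rcomb_cons t ts : ts != [::] -> rcomb (t :: ts) = Node [:: t; rcomb ts].
Proof. by case: ts. Qed.

(** Meant for the suffix that follows the first [1] of a packed word. It may contain no other [1];
    then there is a single block, and the comb of one tree is that tree. *)
Lemma rcomb_split1 w : 0 \notin w ->
  rcomb [seq rbin (rho (pack u)) | u <- split1 w] = rbin (rho (pack w)).
Proof.
move=> w0; have [w1|w1] := boolP (1 \in w); last by rewrite split1_notin.
rewrite [in RHS]rho_split; last first.
  by rewrite /packed_word /= packed_pack andbT -size_eq0 size_pack; case: (w) w1.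
rewrite split1_pack //= -!map_comp; congr rcomb; apply/eq_in_map => u us /=.
by rewrite pack_pack_map //; exact: split1_sub.
Qed.

Lemma first1 w : 1 \in w -> exists u v, w = u ++ 1 :: v /\ 1 \notin u.
Proof.
elim: w => //= x w IH; have [-> _|x1] := eqVneq x 1; first by exists [::], w.
rewrite inE eq_sym (negPf x1) /= => /IH[u [v [-> u1]]].
by exists (x :: u), v; rewrite inE negb_or eq_sym x1.
Qed.

(** Ties are broken from left to right, so the leftmost minimum of the word is the one that becomes
    the minimum of its standardization. *)
Lemma std_rel_split1 u w v : 1 \notin u -> 0 \notin u ++ w -> is_perm v ->
    std_rel (u ++ 1 :: w) v ->
  exists v1 v2, [/\ v = v1 ++ 1 :: v2, 1 \notin v1, 1 \notin v2,
                    std_rel u v1 & std_rel w v2].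
Proof.
move=> u1 uw0 vP H; have /andP[/eqP sE _] := H.
have [pv uv] : packed v /\ uniq v by move: vP; rewrite is_permE => /andP.
have v0 : 0 \notin v by case/andP: pv.
have v1 : 1 \in v by apply: packed_mem1 pv; rewrite -size_eq0 -sE size_cat addnS.
have su : size u < size v by rewrite -sE size_cat /= addnS ltnS leq_addr.
have [a [y [b [vE sa]]]] : exists a y b, v = a ++ y :: b /\ size u = size a.
  exists (take (size u) v), (nth 0 v (size u)), (drop (size u).+1 v).
  by rewrite -drop_nth // cat_take_drop size_takel // ltnW.
rewrite {}vE in v0 v1 uv sE H *; clear su pv vP.
move: sE; rewrite !size_cat sa /= => /addnI[sb].
move: H => /(std_rel_cat sa)[Ha]; rewrite -[1 :: w]cat1s -[y :: b]cat1s.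
case/(@std_rel_cat [:: 1] w [:: y] b erefl) => _ Hb /allrelP yb /allrelP ay.
(* A letter [1] of [v] in [a] would correspond to a letter of [u], at least 2; this descent to the
   [1] of [w] would force [y] to be at most 1. A letter [1] in [b] corresponds to a letter at least
   1, which would force [y < 1]. *)
have y1 : y = 1.
  move: v1; rewrite mem_cat inE.
  case/or3P => [/(mem_zipr sa)[x xu xa]|/eqP->//|/(mem_zipr sb)[x xw xb]].
    have /eqP := ay _ (1, y) xa (mem_head _ _); rewrite /= => E.
    have x2 : x <= 1 = false.
      apply/negP => x1; case: (ltngtP x 1) x1 => // [|E1]; last by rewrite -E1 xu in u1.
      by rewrite ltnS leqn0 => /eqP E1; case/negP: uw0; rewrite mem_cat -E1 xu.
    have ya : 1 \in a by have [] := mem_zip_pair xa.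
    move: E; rewrite x2; case: y uv v0 {yb Hb ay} => [|[|y]] // uv.
    by rewrite mem_cat inE orbT.
  have /eqP := yb (1, y) _ (mem_head _ _) xb; rewrite /=.
  have -> : 1 <= x by rewrite lt0n; apply: contraNneq uw0 => <-; rewrite mem_cat xw orbT.
  by case: y v0 {yb Hb ay uv} => //; rewrite mem_cat inE orbT.
subst y; exists a, b; split=> //; move: uv;
  rewrite cat_uniq /= negb_or => /and4P[_ /andP[]] //.
Qed.

(** The standardization contains a single [1], at the first [1] of [w], so its tree has a binary
    root. The left subtree comes from the first block of [w]; the right one comes from the whole
    remaining suffix and is the comb of the other blocks. *)
Lemma rho_std w : packed w -> rho (std w) = rbin (rho w).
Proof.
have [n] := ubnP (size w); elim: n w => // n IH w; rewrite ltnS => sw pw.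
have [-> //|w0] := eqVneq w [::]; have w1 := packed_mem1 w0 pw.
have [u [w' [wE u1]]] := first1 w1.
have uw0 : 0 \notin u ++ w'.
  by case/andP: pw; rewrite wE !mem_cat inE.
have [|v1 [v2 [vE v11 v21 H1 H2]]] := std_rel_split1 u1 uw0 (std_perm w).
  by rewrite -wE std_relE.
have uv : uniq v1 /\ uniq v2.
  by move: (std_uniq w); rewrite vE cat_uniq /= => /and4P[-> _ _ ->].
have IH' x : size x < size w -> rho (std x) = rbin (rho (pack x)).
  by move=> sx; rewrite -IH ?packed_pack ?std_pack // size_pack (leq_trans sx).
rewrite rho_split; last first.
  have := std_perm w; rewrite is_permE /packed_word /= => /andP[-> _].
  by rewrite vE andbT; case: (v1).
rewrite [rho w]rho_split; last exact/andP.
rewrite vE wE !split1_cat // split1_notin // [RHS]/=.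
rewrite -[RHS]/(rcomb (_ :: map rbin [seq rho (pack x) | x <- split1 w'])).
rewrite rcomb_cons; last by rewrite -size_eq0 !size_map split1_size.
case: uv => uv1 uv2.
rewrite /= -map_comp rcomb_split1 ?(std_rel_std uv1 H1) ?(std_rel_std uv2 H2) ?IH' //.
- by rewrite wE size_cat /= addnS ltnS leq_addl.
- by rewrite wE size_cat /= addnS ltnS leq_addr.
- by move: uw0; rewrite mem_cat negb_or => /andP[].
Qed.

(** * Contractions that undo the binarization *)

Definition contracts (t t' : ptree) : Prop :=
  exists2 E : pred (seq nat),
    forall p, E p -> p \in right_edges t & t' = contract E t.

(** The empty address names no edge, so the value of the predicate there is never consulted. *)
Lemma contract_ext (E E' : pred (seq nat)) t :
  (forall i p, E (i :: p) = E' (i :: p)) -> contract E t = contract E' t.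
Proof.
elim/ptree_nested_ind: t E E' => ts IH E E' EE; rewrite !contractE; congr Node.
elim: ts 0 IH => //= t ts IHts i IH; rewrite EE (IH 0 isT _ (fun p => E' (i :: p))) //.
by rewrite IHts // => j lj; apply: (IH j.+1).
Qed.

Lemma mem_subsets_filter (T : eqType) (a : pred T) s : filter a s \in subsets s.
Proof.
elim: s => //= x s IH; rewrite mem_cat; case: ifP => _; last by rewrite IH orbT.
by rewrite map_f.
Qed.

Lemma belowP t t' : reflect (contracts t t') (t' \in below t).
Proof.
rewrite mem_undup; apply: (iffP mapP) => [[E Es ->]|[E Es ->]].
  by exists [in E] => // p; exact: mem_subsets.
exists [seq p <- right_edges t | E p]; first exact: mem_subsets_filter.
apply: contract_ext => i p; rewrite /= mem_filter; case Ep: (E _) => //.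
by rewrite Es.
Qed.

Lemma contract_node2 (E : pred (seq nat)) a b : ~~ E [:: 0] ->
  contract E (Node [:: a; b]) =
  Node (contract (fun p => E (0 :: p)) a ::
        if E [:: 1] then children (contract (fun p => E (1 :: p)) b)
        else [:: contract (fun p => E (1 :: p)) b]).
Proof. by move=> E0; rewrite contractE /= (negPf E0) /= cats0. Qed.

Lemma right_edges_node2 a b p : p \in right_edges (Node [:: a; b]) ->
  match p with
  | 0 :: q => q \in right_edges a
  | 1 :: q => if q is [::] then internal b else q \in right_edges b
  | _ => false
  end.
Proof.
rewrite right_edgesE /= cats0 !mem_cat => /orP[/mapP[q qa ->] //|].
case/orP => [|/mapP[q qb ->]]; first by case: ifP => // ib; rewrite inE => /eqP->.
by case: q qb => // /(negP (right_edges_nil b)).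
Qed.

(** Contracting the right edge at the root appends the children of the contracted right subtree to
    the root's list, and the comb of that longer list starts with the same binary node. The empty
    address is exempted because, in the predicate passed down to a child, it stands for the edge
    leading to that child. *)
Lemma rbin_contract (E : pred (seq nat)) t : binary t ->
  (forall p, p != [::] -> E p -> p \in right_edges t) -> rbin (contract E t) = t.
Proof.
elim/ptree_nested_ind: t E => -[|a [|b [|c ts]]] //= IH E /and3P[ba bb _] sub.
have Ia := IH 0 isT (fun p => E (0 :: p)) ba; have Ib := IH 1 isT (fun p => E (1 :: p)) bb.
have {}sub p : p != [::] -> E p -> p \in right_edges (Node [:: a; b]) by exact: sub.
have Sa p : p != [::] -> E (0 :: p) -> p \in right_edges a.
  by move=> _ /(sub (0 :: p) isT)/right_edges_node2.
have Sb p : p != [::] -> E (1 :: p) -> p \in right_edges b.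
  by move=> p0 /(sub (1 :: p) isT)/right_edges_node2; case: p p0.
have E0 : ~~ E [:: 0].
  by apply/negP => /(sub [:: 0] isT)/right_edges_node2; rewrite (negPf (right_edges_nil a)).
rewrite -[LHS]/(rbin (contract E (Node [:: a; b]))) contract_node2 //.
rewrite -[LHS]/(rcomb (rbin (contract _ a) :: map rbin _)) Ia //.
case: ifP => [E1|_]; last by rewrite /= Ib.
have ib := right_edges_node2 (sub [:: 1] isT E1).
(* Contraction keeps [b] internal, so the list after the first child is nonempty and [rcomb] really
   creates a binary node. *)
have [_ _ ib'] := contract_wf (binary_schroder bb) Sb.
rewrite rcomb_cons; last by move: ib; rewrite -ib' /internal; case: children.
by congr (Node [:: _; _]); rewrite -[RHS](Ib Sb) /=; case: (contract _ b).
Qed.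

(** [f] tells whether the edge from the root to [b] is contracted as well. *)
Lemma contracts_node2 (f : bool) a b a' b' : contracts a a' -> contracts b b' ->
    (f -> internal b) ->
  contracts (Node [:: a; b]) (Node (a' :: if f then children b' else [:: b'])).
Proof.
move=> [Ea Ha ->] [Eb Hb ->] fb.
exists (fun p => match p with
  | 0 :: q => Ea q | 1 :: q => if q is [::] then f else Eb q | _ => false end).
  move=> [|[|[|//]] q] //; rewrite right_edgesE /= cats0 !mem_cat.
    by move=> /Ha qa; rewrite map_f.
  case: q => [/fb ->|x q /Hb qb]; first by rewrite mem_head /= orbT.
  by rewrite (map_f _ qb) !orbT.
rewrite contract_node2 /=; last by apply/negP => /Ha; apply/negP/right_edges_nil.
congr (Node (_ :: _)); rewrite (@contract_ext _ Eb b) //.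
Qed.

(** The edges to contract are those that [rcomb] created. At the last two children the comb stops
    and the right edge leads to a genuine child, so it is kept. *)
Lemma contracts_rbin t : schroder t -> contracts (rbin t) t.
Proof.
elim/ptree_nested_ind: t => ts IH /= /andP[s1 /(all_nthP leaf) sts].
have {sts}IH t : t \in ts -> contracts (rbin t) t.
  by case/(nthP leaf) => i li <-; apply: IH => //; apply: sts.
elim: ts s1 IH => [_ _|a [|b ts] IHts s1 IH] //; first by exists pred0.
have Ha := IH a (mem_head _ _).
have {}IH t : t \in b :: ts -> contracts (rbin t) t.
  by move=> tb; apply: IH; rewrite inE tb orbT.
rewrite [rcomb _]rcomb_cons //.
case: ts => [|c ts] in IHts IH s1 *.
  by apply: (@contracts_node2 false) => //; apply: IH; exact: mem_head.
by have := contracts_node2 (f := true) Ha (IHts isT IH); apply.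
Qed.

Lemma mem_below t t' : binary t -> schroder t' -> (t' \in below t) = (rbin t' == t).
Proof.
move=> bt st; apply/belowP/eqP => [[E Es ->]|<-]; last exact: contracts_rbin.
by apply: rbin_contract => // p _; exact: Es.
Qed.

(** * Quasi-shuffles *)

Lemma packed_gt0 w x : packed w -> x \in w -> 0 < x.
Proof. by case/andP=> w0 _ xw; rewrite lt0n; apply: contraNneq w0 => <-. Qed.

Lemma packed_word_max w : packed_word w -> 0 < maxl w.
Proof.
case/andP=> w0 pw; have := packed_mem1 w0 pw.
by rewrite (mem_packed pw) mem_iota => /andP[_].
Qed.

Lemma qshP a b z : reflect
  [/\ packed z, size z = a + b, sorted ltn (take a z) & sorted ltn (drop a z)]
  (z \in qsh a b).
Proof.
rewrite mem_filter mem_surj -andbA.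
by apply: (iffP and4P) => [[-> -> -> /eqP->]|[-> -> -> ->]].
Qed.

Lemma letter_mono z a : sorted ltn (take a z) ->
  {in [pred x | 0 < x <= a & x <= size z] &, {mono letter z : x y / x <= y}}.
Proof.
move=> sz; apply: leq_mono_in => x y.
rewrite !inE => /andP[/andP[x0 xa] xz] /andP[/andP[y0 ya] yz] lt.
have := @sorted_ltn_nth _ ltn ltn_trans 0 (take a z) sz x.-1 y.-1.
by rewrite !inE size_take_min !leq_min !nth_take ?prednK ?xa ?ya ?xz ?yz //; apply; lia.
Qed.

Lemma letter_drop z a x : 0 < x -> letter z (a + x) = letter (drop a z) x.
Proof. by case: x => // x _; rewrite /letter addnS /= nth_drop. Qed.

Lemma letter_catl s1 s2 x : 0 < x <= size s1 -> letter (s1 ++ s2) x = letter s1 x.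
Proof. by case: x => // x /= lx; rewrite /letter nth_cat lx. Qed.

Lemma letter_catr s1 s2 x : 0 < x -> letter (s1 ++ s2) (size s1 + x) = letter s2 x.
Proof. by move=> x0; rewrite letter_drop // drop_size_cat. Qed.

Lemma comp_catshift z u v : comp z (catshift u v) =
  map (letter z) u ++ map (fun x => letter z (maxl u + x)) v.
Proof. by rewrite /comp map_cat -map_comp. Qed.

Lemma rank_sort w : map (rank w) (sort leq (undup w)) = iota 1 (size (undup w)).
Proof.
set s := sort _ _.
have us : uniq s by rewrite sort_uniq undup_uniq.
have sw : s =i w by move=> x; rewrite mem_sort mem_undup.
have sl : sorted ltn s by rewrite ltn_sorted_uniq_leq us sort_sorted //; exact: leq_total.
apply: (irr_sorted_eq ltn_trans ltnn); last 1 first.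
- move=> x; rewrite -mem_pack; exact: (eq_mem_map (rank w) sw).
- rewrite sorted_map; apply: (@sub_in_sorted _ [in w] ltn) sl => [x y _ yw lt|].
    exact: rank_lt.
  by apply/allP => x; rewrite sw.
- exact: iota_ltn_sorted.
Qed.

(** The sorted list of distinct letters, read as a map on positions, undoes packing. It supplies the
    two increasing halves of the quasi-shuffle rebuilt in [shuffleP]. *)
Lemma letter_sort_rank w x : x \in w -> letter (sort leq (undup w)) (rank w x) = x.
Proof.
set s := sort _ _ => xw; have xs : x \in s by rewrite mem_sort mem_undup.
have lt : index x s < size s by rewrite index_mem.
have := congr1 (fun l => nth 0 l (index x s)) (rank_sort w).
rewrite (nth_map 0) // nth_index // nth_iota; last by rewrite size_sort in lt.
by move=> ->; rewrite /letter add1n nth_index.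
Qed.

Lemma maxl_pack w : maxl (pack w) = size (undup w).
Proof. by have [] := packed_mem (mem_pack w). Qed.

Section Shuffle.
Variables (u v : word).
Hypotheses (pu : packed_word u) (pv : packed_word v).

Let pu' : packed u. Proof. by case/andP: pu. Qed.
Let pv' : packed v. Proof. by case/andP: pv. Qed.

Lemma size_comp z : size (comp z (catshift u v)) = size u + size v.
Proof. by rewrite comp_catshift size_cat !size_map. Qed.

Lemma take_comp z : take (size u) (comp z (catshift u v)) = map (letter z) u.
Proof. by rewrite comp_catshift take_size_cat ?size_map. Qed.

Lemma drop_comp z : drop (size u) (comp z (catshift u v)) =
  map (letter (drop (maxl u) z)) v.
Proof.
rewrite comp_catshift drop_size_cat ?size_map //.
by apply/eq_in_map => x /(packed_gt0 pv') x0; exact: letter_drop.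
Qed.

Lemma pack_take_comp z : z \in qsh (maxl u) (maxl v) ->
  pack (take (size u) (comp z (catshift u v))) = u.
Proof.
case/qshP=> pz sz s1 _; rewrite take_comp pack_map ?pack_packed //.
by apply: sub_in2 (letter_mono s1) => x; rewrite (mem_packed pu') mem_iota inE sz; lia.
Qed.

Lemma pack_drop_comp z : z \in qsh (maxl u) (maxl v) ->
  pack (drop (size u) (comp z (catshift u v))) = v.
Proof.
case/qshP=> pz sz _ s1; rewrite drop_comp pack_map ?pack_packed //.
have := @letter_mono (drop (maxl u) z) (maxl v).
rewrite take_oversize size_drop sz ?addKn // => /(_ s1).
by apply: sub_in2 => x; rewrite (mem_packed pv') mem_iota inE; lia.
Qed.

Lemma mem_comp z : z \in qsh (maxl u) (maxl v) -> comp z (catshift u v) =i z.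
Proof.
case/qshP=> pz sz _ _; rewrite -[in X in _ =i X](map_letter z) sz.
exact/eq_mem_map/mem_catshift.
Qed.

(** [catshift u v] contains every position of [z], so all the values of [z] can be read off the
    composite. *)
Lemma comp_inj : {in qsh (maxl u) (maxl v) &, injective (fun z => comp z (catshift u v))}.
Proof.
move=> z z' /qshP[_ sz _ _] /qshP[_ sz' _ _] /eq_in_map H.
rewrite -(map_letter z) -(map_letter z') sz sz'; apply/eq_in_map => x xI.
by apply: H; rewrite mem_catshift.
Qed.

Lemma shuffleP w :
  reflect (exists2 z, z \in qsh (maxl u) (maxl v) & w = comp z (catshift u v))
    [&& packed w, size w == size u + size v, pack (take (size u) w) == u &
        pack (drop (size u) w) == v].
Proof.
apply: (iffP and4P) => [[pw /eqP sw /eqP Eu /eqP Ev]|[z zq ->]]; last first.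
  rewrite size_comp pack_take_comp // pack_drop_comp // !eqxx; split=> //.
  by have /andP[] := packed_word_comp pu pv zq.
set w1 := take _ w in Eu; set w2 := drop _ w in Ev.
set s1 := sort leq (undup w1); set s2 := sort leq (undup w2).
have m1 : maxl u = size s1 by rewrite -Eu maxl_pack size_sort.
have m2 : maxl v = size s2 by rewrite -Ev maxl_pack size_sort.
have H s : sorted ltn (sort leq (undup s)).
  by rewrite ltn_sorted_uniq_leq sort_uniq undup_uniq sort_sorted //; exact: leq_total.
(* The quasi-shuffle is forced: on each half it must list increasingly the distinct letters of the
   corresponding part of [w]. *)
exists (s1 ++ s2).
  apply/qshP; rewrite m1 m2 size_cat take_size_cat // drop_size_cat // !H; split=> //.
  have [] // := @packed_mem (s1 ++ s2) (maxl w).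
  move=> x; rewrite mem_cat !mem_sort !mem_undup -mem_cat cat_take_drop.
  exact: mem_packed.
rewrite comp_catshift -[LHS](cat_take_drop (size u)) -/w1 -/w2; congr (_ ++ _).
  rewrite -[in map _ u]Eu -map_comp -[LHS]map_id; apply/eq_in_map => x xw1 /=.
  rewrite letter_catl ?letter_sort_rank //.
  have : rank w1 x \in pack w1 by exact: map_f.
  by rewrite mem_pack mem_iota add1n ltnS size_sort.
rewrite -[in map _ v]Ev -map_comp -[LHS]map_id; apply/eq_in_map => x xw2 /=.
rewrite m1 letter_catr ?letter_sort_rank //.
by apply: (packed_gt0 (packed_pack w2)); exact: map_f.
Qed.

Lemma perm_shuffle :
  perm_eq [seq comp z (catshift u v) | z <- qsh (maxl u) (maxl v)]
    [seq w <- surj (size u + size v) |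
      (pack (take (size u) w) == u) && (pack (drop (size u) w) == v)].
Proof.
apply: uniq_perm.
- rewrite map_inj_in_uniq; [exact/filter_uniq/surj_uniq | exact: comp_inj].
- exact/filter_uniq/surj_uniq.
move=> w; rewrite mem_filter mem_surj andbC -andbA.
by apply/mapP/shuffleP => -[z zq ->]; exists z.
Qed.

(** [z] increases on its first half, so only its first position can take the value 1 there, and [u]
    does contain the letter 1. *)
Lemma mem1_take_comp z : z \in qsh (maxl u) (maxl v) ->
  (1 \in take (size u) (comp z (catshift u v))) = (letter z 1 == 1).
Proof.
move=> /qshP[pz sz s1 _]; have u0 := packed_word_max pu.
rewrite take_comp; apply/mapP/eqP => [[x xu E]|E]; last first.
  by exists 1; rewrite // (mem_packed pu') mem_iota /= add1n ltnS.
have l0 : 0 < letter z 1 by apply: (packed_gt0 pz); apply: mem_nth; rewrite sz; lia.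
have xb : 0 < x <= maxl u by move: xu; rewrite (mem_packed pu') mem_iota add1n ltnS.
apply/eqP; rewrite eqn_leq l0 andbT E (letter_mono s1) ?inE ?sz; lia.
Qed.

Lemma mem1_drop_comp z : z \in qsh (maxl u) (maxl v) ->
  (1 \in drop (size u) (comp z (catshift u v))) = (letter z (maxl u).+1 == 1).
Proof.
move=> /qshP[pz sz _ s1]; have v0 := packed_word_max pv.
rewrite drop_comp -[(maxl u).+1]addn1 letter_drop //.
apply/mapP/eqP => [[x xv E]|E]; last first.
  by exists 1; rewrite // (mem_packed pv') mem_iota /= add1n ltnS.
have l0 : 0 < letter (drop (maxl u) z) 1.
  apply: (packed_gt0 pz); apply: (@mem_drop (maxl u)); apply: mem_nth.
  by rewrite size_drop sz; lia.
have xb : 0 < x <= maxl v by move: xv; rewrite (mem_packed pv') mem_iota add1n ltnS.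
have := @letter_mono (drop (maxl u) z) (maxl v).
rewrite take_oversize size_drop sz ?addKn // => /(_ s1) M.
apply/eqP; rewrite eqn_leq l0 andbT E M ?inE; lia.
Qed.

(** On each increasing half only the starting position can have value 1. This makes the three
    conditions on the preimage of 1 depend on two letters of [z] alone. *)
Lemma preim1E z : z \in qsh (maxl u) (maxl v) ->
  preim1 z = (if letter z 1 == 1 then [:: 1] else [::]) ++
             (if letter z (maxl u).+1 == 1 then [:: (maxl u).+1] else [::]).
Proof.
move=> /qshP[pz sz s1 s2]; have u0 := packed_word_max pu; have v0 := packed_word_max pv.
have l0 i : 0 < i <= maxl u + maxl v -> 0 < letter z i.
  by move=> ib; apply: (packed_gt0 pz); apply: mem_nth; rewrite sz; lia.
have F c d : 0 < d ->
    (forall i j, c <= i -> i < j -> j < c + d -> letter z i < letter z j) ->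
    0 < c -> c + d <= (maxl u + maxl v).+1 ->
    [seq i <- iota c d | letter z i == 1] = if letter z c == 1 then [:: c] else [::].
  case: d => //= d _ M c0 cd; rewrite (eq_in_filter (a2 := pred0)) ?filter_pred0 //.
  move=> i; rewrite mem_iota => ib /=; apply/negP => /eqP E.
  have lc : 0 < letter z c by apply: l0; lia.
  by have: letter z c < letter z i; [apply: M; lia | rewrite E ltnNge lc].
rewrite /preim1 sz iotaD filter_cat !F ?add1n //; try lia.
- move=> i j ci ij ja; have := @letter_mono (drop (maxl u) z) (maxl v).
  rewrite take_oversize size_drop sz ?addKn // => /(_ s2) M.
  rewrite -(subnKC (_ : maxl u <= i)) -1?(subnKC (_ : maxl u <= j)); try lia.
  by rewrite !letter_drop ?ltnNge ?M ?inE; lia.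
- by move=> i j ci ij ja; rewrite !ltnNge (letter_mono s1) ?inE ?sz; lia.
Qed.

Lemma mem1_comp z : z \in qsh (maxl u) (maxl v) ->
  (letter z 1 == 1) || (letter z (maxl u).+1 == 1).
Proof.
move=> zq; rewrite -mem1_take_comp // -mem1_drop_comp // -mem_cat cat_take_drop.
rewrite mem_comp //; have [pz sz _ _] := qshP _ _ _ zq.
apply: packed_mem1 pz; rewrite -size_eq0 sz.
by have := packed_word_max pu; lia.
Qed.

End Shuffle.

Lemma is_perm_comp s t z : is_perm s -> is_perm t -> z \in qsh (maxl s) (maxl t) ->
  is_perm (comp z (catshift s t)) = is_perm z.
Proof.
move=> sP tP /qshP[_ sz _ _].
have H : perm_eq (comp z (catshift s t)) z.
  rewrite -[X in perm_eq _ X](map_letter z) sz perm_map //.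
  rewrite iotaD (is_perm_maxl sP) perm_cat // addnC iotaDl.
  by rewrite (is_perm_maxl tP) (is_perm_maxl sP) perm_map.
rewrite /is_perm (perm_size H); apply/idP/idP; apply: perm_trans => //.
by rewrite perm_sym.
Qed.

(** The [1] of [std w] stands at the leftmost [1] of [w]. If the two words had their [1] only on
    opposite sides of position [n], then [std_pair] would fail for the two positions concerned. *)
Lemma mem1_take_std n w : packed w -> (1 \in take n (std w)) = (1 \in take n w).
Proof.
move=> pw; have := std_relE w; have := size_std w.
have ps : packed (std w) by have := std_perm w; rewrite is_permE => /andP[].
move: (std_uniq w) ps; move: (std w) => v uv pv sE.
have [w0|w0] := eqVneq w [::]; first by move: sE; rewrite w0 => /size0nil ->.
have v1 : 1 \in v by apply: packed_mem1 pv; rewrite -size_eq0 sE size_eq0.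
have w1 := packed_mem1 w0 pw.
have s1 : size (take n w) = size (take n v) by rewrite !size_take_min sE.
have s2 : size (drop n w) = size (drop n v) by rewrite !size_drop sE.
rewrite -{1}(cat_take_drop n v) -{1}(cat_take_drop n w).
case/(std_rel_cat s1) => _ _ /allrelP R.
have gtw x : x \in w -> 0 < x by apply: packed_gt0.
have gtv x : x \in v -> 0 < x by apply: packed_gt0.
apply/idP/idP => [H|H].
  move: w1; rewrite -{1}(cat_take_drop n w) mem_cat => /orP[//|].
  case/(mem_zipl s2)=> y yv yz; have [x xw xz] := mem_zipr s1 H.
  have /eqP /= := R _ _ xz yz.
  have : y != 1.
    move: uv; rewrite -{1}(cat_take_drop n v) cat_uniq => /and3P[_ /hasPn/(_ y yv) + _].
    by apply: contraNneq => ->.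
  have := gtv y (mem_drop yv); have := gtw x (mem_take xw).
  move=> x0 y0 y1; rewrite ltn_neqAle eq_sym y1 y0 /= => /esym x1.
  by have /eqP <- : x == 1 by rewrite eqn_leq x1.
move: v1; rewrite -{1}(cat_take_drop n v) mem_cat => /orP[//|].
case/(mem_zipr s2)=> x xw xz; have [y yv yz] := mem_zipl s1 H.
have /eqP := R _ _ yz xz.
by rewrite /= ltnNge (gtv y (mem_take yv)) (gtw x (mem_drop xw)).
Qed.

(** * Cutting words by letter values *)

Definition lowcut (w : word) (i : nat) : word := restr w (index_iota 1 i.+1).
Definition highcut (w : word) (i : nat) : word :=
  restr w (index_iota i.+1 (maxl w).+1).

Lemma lowcutE w i : packed w -> lowcut w i = [seq x <- w | x <= i].
Proof.
move=> pw; apply: eq_in_filter => x xw.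
by rewrite mem_index_iota ltnS (packed_gt0 pw xw).
Qed.

Lemma highcutE w i : packed w -> highcut w i = [seq x <- w | ~~ (x <= i)].
Proof.
move=> pw; apply: eq_in_filter => x; rewrite (mem_packed pw) mem_iota mem_index_iota.
by rewrite -ltnNge => /andP[_ ->]; rewrite andbT.
Qed.

Lemma size_lowcut_highcut w i : packed w -> size (lowcut w i) + size (highcut w i) = size w.
Proof. by move=> pw; rewrite lowcutE // highcutE // !size_filter count_predC. Qed.

Lemma lowcut_packed w i : packed w -> i <= maxl w ->
  packed (lowcut w i) /\ maxl (lowcut w i) = i.
Proof.
move=> pw li; apply: packed_mem => x.
rewrite mem_filter (mem_packed pw) mem_index_iota !mem_iota; lia.
Qed.

(** All letters from [i + 1] to the maximum occur, so packing merely subtracts [i]. Hence [i] and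
    the packed half recover the half itself. *)
Lemma pack_highcut w i : packed w ->
  highcut w i = map (addn i) (pack (highcut w i)).
Proof.
move=> pw; set h := highcut w i.
have hE x : (x \in h) = (i < x <= maxl w).
  rewrite mem_filter (mem_packed pw) mem_index_iota !mem_iota; lia.
have M : {in h &, {mono subn^~ i : x y / x <= y}}.
  by move=> x y; rewrite !hE => xh yh /=; lia.
have <- : map (subn^~ i) h = pack h.
  rewrite -(pack_map M) pack_packed //.
  have [] // := @packed_mem (map (subn^~ i) h) (maxl w - i).
  move=> x; rewrite mem_iota; apply/mapP/idP => [[y + ->]|xb]; first by rewrite hE; lia.
  by exists (x + i); rewrite ?hE ?addnK //; lia.
rewrite -map_comp -[LHS]map_id; apply/eq_in_map => x; rewrite hE /=; lia.
Qed.

(** Frees the comparison from the order of the positions: when [q] comes first, distinctness in [v]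
    turns the negated [std_pair] into a strict inequality. *)
Lemma std_rel_lt w v p q : uniq v -> std_rel w v ->
  p \in zip w v -> q \in zip w v -> p.1 < q.1 -> p.2 < q.2.
Proof.
move=> uv /std_relP[sE H] /(nthP (0, 0))[a la <-] /(nthP (0, 0))[b lb <-].
move: la lb; rewrite !size_zip -sE minnn => la lb; rewrite !nth_zip //= => lt.
case: (ltngtP a b) => [ab|ba|E]; last by move: lt; rewrite E ltnn.
  by rewrite H ?ab // ltnW.
rewrite ltnNge leq_eqVlt nth_uniq -?sE // H ?ba // negb_or neq_ltn ba /=.
by rewrite -ltnNge.
Qed.

Lemma unzip2_std w v : std_rel w v -> unzip2 (zip w v) = v.
Proof. by case/andP=> /eqP sE _; rewrite unzip2_zip ?sE. Qed.

Lemma unzip1_std w v : std_rel w v -> unzip1 (zip w v) = w.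
Proof. by case/andP=> /eqP sE _; rewrite unzip1_zip ?sE. Qed.

(* Standardization sends the letters at most [i] onto an initial interval. *)
Lemma std_threshold w v i p : is_perm v -> std_rel w v -> p \in zip w v ->
  (p.1 <= i) = (p.2 <= count (leq^~ i) w).
Proof.
move=> vP H pz; have [pv uv] : packed v /\ uniq v by move: vP; rewrite is_permE => /andP.
(* Both directions compare cardinalities, the second components of [Z] being distinct. If [p.1 <= i]
   they include all of 1, ..., [p.2]; otherwise they all lie below [p.2]. *)
set Z := [seq q <- zip w v | q.1 <= i].
have sZ : count (leq^~ i) w = size (unzip2 Z).
  by rewrite -[in LHS](unzip1_std H) count_map size_map size_filter.
have uZ : uniq (unzip2 Z).
  apply: (@subseq_uniq _ _ v) uv; rewrite -[X in subseq _ X](unzip2_std H).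
  exact/map_subseq/filter_subseq.
rewrite sZ; apply/idP/idP => [p1|].
  rewrite -[X in X <= _](size_iota 1); apply: uniq_leq_size (iota_uniq _ _) _ => y yI.
  have : y \in v.
    have [_] := mem_zip_pair pz; rewrite (mem_packed pv) mem_iota => p2v.
    by move: yI; rewrite (mem_packed pv) !mem_iota; lia.
  have /andP[/eqP sE _] := H; case/(mem_zipr sE) => x xw xy.
  apply/mapP; exists (x, y) => //; rewrite mem_filter xy andbT /=.
  rewrite leqNgt; apply/negP => ix; have := std_rel_lt uv H pz xy (leq_ltn_trans p1 ix).
  by move: yI; rewrite mem_iota /=; lia.
apply: contraTT; rewrite -!ltnNge => p1.
have p20 : 0 < p.2 by have [_] := mem_zip_pair pz; exact: packed_gt0.
rewrite -(prednK p20) ltnS -[X in _ <= X](size_iota 1).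
apply: uniq_leq_size uZ _ => _ /mapP[q + ->].
rewrite mem_filter => /andP[q1 qz]; rewrite mem_iota add1n prednK //.
rewrite (std_rel_lt uv H qz pz (leq_ltn_trans q1 p1)) andbT.
by have [_] := mem_zip_pair qz; exact: packed_gt0.
Qed.

Lemma pairwise_split (T : eqType) (r : rel T) (a : pred T) s :
    pairwise r [seq x <- s | a x] -> pairwise r [seq x <- s | ~~ a x] ->
    {in s &, forall x y, a x != a y -> r x y} -> pairwise r s.
Proof.
elim: s => //= x s IH H1 H2 H; apply/andP; split.
  apply/allP => y ys; have [E|ne] := eqVneq (a x) (a y).
    case ax: (a x) H1 H2 E => /= H1 H2 E.
      by case/andP: H1 => /allP + _; apply; rewrite mem_filter -E ys.
    by case/andP: H2 => /allP + _; apply; rewrite mem_filter -E ys.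
  by apply: H; rewrite ?mem_head // inE ys orbT.
apply: IH.
- by case: (a x) H1 => //= /andP[].
- by case: (a x) H2 => //= /andP[].
- by move=> y z ys zs; apply: H; rewrite inE ?ys ?zs orbT.
Qed.

Lemma std_rel_filter (a : pred (nat * nat)) w v : std_rel w v ->
  std_rel (unzip1 (filter a (zip w v))) (unzip2 (filter a (zip w v))).
Proof.
by case/andP=> _ H; rewrite /std_rel !size_map eqxx zip_unzip pairwise_filter.
Qed.

Section Cut.
Variables (w v : word) (i : nat).
Hypotheses (pw : packed w) (vP : is_perm v) (H : std_rel w v).
Let j := size (lowcut w i).
Let pv : packed v. Proof. by move: vP; rewrite is_permE => /andP[]. Qed.
Let uv : uniq v. Proof. by move: vP; rewrite is_permE => /andP[]. Qed.

Lemma cut_threshold p : p \in zip w v -> (p.1 <= i) = (p.2 <= j).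
Proof. by move/(std_threshold i vP H) ->; rewrite /j lowcutE // size_filter. Qed.

Lemma lowcut_unzip (F := [seq p <- zip w v | p.2 <= j]) :
  lowcut w i = unzip1 F /\ lowcut v j = unzip2 F.
Proof.
rewrite !lowcutE // -[in LHS](unzip1_std H) -[X in _ /\ filter _ X = _](unzip2_std H).
by rewrite !filter_map; split=> //; congr map; exact/eq_in_filter/cut_threshold.
Qed.

Lemma highcut_unzip (F := [seq p <- zip w v | ~~ (p.2 <= j)]) :
  highcut w i = unzip1 F /\ highcut v j = unzip2 F.
Proof.
rewrite !highcutE // -[in LHS](unzip1_std H) -[X in _ /\ filter _ X = _](unzip2_std H).
rewrite !filter_map; split=> //; congr map.
by apply/eq_in_filter => p /cut_threshold /= ->.
Qed.

Lemma zip_lowcut : zip (lowcut w i) (lowcut v j) = [seq p <- zip w v | p.2 <= j].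
Proof. by have [-> ->] := lowcut_unzip; exact: zip_unzip. Qed.

Lemma zip_highcut : zip (highcut w i) (highcut v j) = [seq p <- zip w v | ~~ (p.2 <= j)].
Proof. by have [-> ->] := highcut_unzip; exact: zip_unzip. Qed.

Lemma std_rel_lowcut : std_rel (lowcut w i) (lowcut v j).
Proof. by have [-> ->] := lowcut_unzip; exact: std_rel_filter. Qed.

Lemma std_rel_highcut : std_rel (highcut w i) (highcut v j).
Proof. by have [-> ->] := highcut_unzip; exact: std_rel_filter. Qed.

End Cut.

(** Positions on opposite sides of matching thresholds compare strictly, and in the same way, in
    both words. *)
Lemma threshold_std_pair m n (p q : nat * nat) :
  (p.1 <= m) = (p.2 <= n) -> (q.1 <= m) = (q.2 <= n) ->
  (p.2 <= n) != (q.2 <= n) -> std_pair p q.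
Proof. by rewrite /std_pair; lia. Qed.

Lemma mem_filter_surj P n w :
  (w \in [seq w <- surj n | P w]) = [&& P w, packed w & size w == n].
Proof. by rewrite mem_filter mem_surj. Qed.

(** * Cuts of all the words with a given standardization *)

Section CutPerm.
Variable s : word.
Hypothesis sP : perm_word s.
Let n := size s.
Let sP' : is_perm s. Proof. by case/andP: sP. Qed.
Let ps : packed s. Proof. by move: sP'; rewrite is_permE => /andP[]. Qed.
Let us : uniq s. Proof. by move: sP'; rewrite is_permE => /andP[]. Qed.
Let ms : maxl s = n. Proof. exact: is_perm_maxl. Qed.
Let n0 : 0 < n. Proof. by rewrite lt0n size_eq0; case/andP: sP. Qed.

Lemma size_lowcut_perm j : j <= n -> size (lowcut s j) = j.
Proof.
move=> lj; have [pl ml] := lowcut_packed ps (leq_trans lj (eq_leq (esym ms))).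
by rewrite -[RHS]ml is_perm_maxl // is_permE pl filter_uniq.
Qed.

(* [cut_left] lists the terms of the coproduct of [Psi s] and [cut_right] those
   of the image under [Psi] of the coproduct of [s], for [Delta_prec] if [b] and
   for [Delta_succ] otherwise. *)
Definition cut_left (b : bool) : seq (word * word) :=
  [seq (lowcut w i, pack (highcut w i)) |
     w <- [seq w <- surj n | std w == s],
     i <- [seq i <- index_iota 1 (maxl w) | (letter w 1 <= i) == b]].

Definition cut_right (b : bool) : seq (word * word) :=
  [seq p | j <- [seq j <- index_iota 1 n | (letter s 1 <= j) == b],
           p <- [seq (u, v) | u <- [seq u <- surj j | std u == lowcut s j],
                              v <- [seq v <- surj (n - j) | std v == pack (highcut s j)]]].

Lemma cut_left_uniq b : uniq (cut_left b).
Proof.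
apply: allpairs_uniq_dep => [|w _|].
- exact/filter_uniq/surj_uniq.
- exact/filter_uniq/iota_uniq.
move=> _ _ /allpairsPdep[w [i [+ + ->]]] /allpairsPdep[w' [i' [+ + ->]]] /= E.
rewrite !mem_filter_surj !(mem_filter _ _ (index_iota _ _)) !mem_index_iota.
move=> /andP[/eqP sw /andP[pw _]] /andP[_ /andP[i1 im]].
move=> /andP[/eqP sw' /andP[pw' _]] /andP[_ /andP[i1' im']].
have R := std_relE w; have R' := std_relE w'; rewrite sw in R; rewrite sw' in R'.
case: E => El Eh.
have [_ Ei] := lowcut_packed pw (ltnW im); have [_ Ei'] := lowcut_packed pw' (ltnW im').
have ii : i = i' by rewrite -Ei -Ei' El.
subst i'; have {}Eh : highcut w i = highcut w' i.
  by rewrite (pack_highcut i pw) (pack_highcut i pw') Eh.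
suff -> : w = w' by [].
(* The halves give the pairs (letter of the word, letter of [s]) only up to order. The letters of
   [s] being distinct, they put each pair back at its position. *)
have Z : perm_eq (zip w s) (zip w' s).
  have C j (z : seq (nat * nat)) :
      perm_eq ([seq p <- z | p.2 <= j] ++ [seq p <- z | ~~ (p.2 <= j)]) z.
    exact: permEl (perm_filterC _ z).
  rewrite -(permPl (C (size (lowcut w i)) _)) -zip_lowcut // -zip_highcut // El Eh.
  by rewrite zip_lowcut // zip_highcut.
have /andP[/eqP sE _] := R; have /andP[/eqP sE' _] := R'.
apply: (@eq_from_nth _ 0) => [|k lk]; first by rewrite sE sE'.
have : nth (0, 0) (zip w s) k \in zip w' s.
  by rewrite -(perm_mem Z) mem_nth // size_zip -sE minnn.
case/(nthP (0, 0)) => m; rewrite size_zip sE' minnn => lm.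
rewrite !nth_zip // => -[<- /eqP].
by rewrite nth_uniq ?sE // => [/eqP->|]; rewrite -?sE.
Qed.

Lemma cut_right_uniq b : uniq (cut_right b).
Proof.
apply: allpairs_uniq_dep => [|j _|].
- by rewrite filter_uniq // iota_uniq.
- apply: allpairs_uniq; try exact/filter_uniq/surj_uniq.
  by case=> a c [a' c'] _ _ [-> ->].
move=> _ _ /allpairsPdep[j [p [_ + ->]]] /allpairsPdep[j' [p' [_ + ->]]] /= E.
subst p'; case/allpairsP => -[u v] [/= + _ ->] /allpairsP[[u' v'] [/= u1 _ [uu _]]].
move: u1; rewrite -{}uu !mem_filter_surj => /and3P[_ _ /eqP ju] /and3P[_ _ /eqP ju'].
by rewrite -ju -ju'.
Qed.

(** The corresponding cut of [s] is at the number [j] of letters of [w] that are at most [i]. Both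
    halves being nonempty, [j] is an admissible level, and the threshold property keeps the first
    letter on the same side, which preserves [b]. *)
Lemma cut_left_right b : {subset cut_left b <= cut_right b}.
Proof.
move=> _ /allpairsPdep[w [i [+ + ->]]].
rewrite mem_filter_surj mem_filter mem_index_iota.
move=> /andP[/eqP sw /andP[pw /eqP szw]] /andP[bE /andP[i1 im]].
have R := std_relE w; rewrite sw in R.
set j := size (lowcut w i).
have [[pl ml] ph] := (lowcut_packed pw (ltnW im), packed_pack (highcut w i)).
have w0 : packed_word w by rewrite /packed_word /= pw andbT -size_eq0 szw -lt0n.
have ib : 0 < i < maxl w by rewrite i1.
have [/andP[l0 _] /andP[h0 _]] := packed_word_cut w0 ib.
have jb : 1 <= j < n.
  rewrite lt0n size_eq0 l0 -szw -(size_lowcut_highcut i pw) -addn1 leq_add2l lt0n.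
  by rewrite size_eq0 -size_eq0 -(size_pack (highcut w i)) size_eq0.
have lj : j <= maxl s by rewrite ms; case/andP: jb => _ /ltnW.
apply/allpairsPdep; exists j, (lowcut w i, pack (highcut w i)); split=> //.
  rewrite mem_filter mem_index_iota jb andbT -(eqP bE); apply/eqP.
  have z0 : (letter w 1, letter s 1) \in zip w s.
    have /andP[/eqP sE _] := R.
    by rewrite /letter /= -(nth_zip 0 0) // mem_nth // size_zip -sE minnn szw.
  by have /= -> := @cut_threshold w s i pw sP' R _ z0.
apply/allpairsP; exists (lowcut w i, pack (highcut w i)); split=> //=.
  rewrite mem_filter_surj pl /= -/j eqxx andbT -std_relEq ?std_rel_lowcut //.
  by rewrite is_permE filter_uniq // (lowcut_packed ps lj).1.
rewrite mem_filter_surj ph size_pack /= std_pack.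
rewrite -std_relEq ?std_rel_packr ?std_rel_highcut //.
  by apply/eqP; rewrite -szw -(size_lowcut_highcut i pw) -/j addKn.
by rewrite is_permE packed_pack uniq_pack filter_uniq.
Qed.

Lemma cut_right_left b : {subset cut_right b <= cut_left b}.
Proof.
move=> _ /allpairsPdep[j [_ [+ /allpairsP[[u v] [/= + + ->]] ->]]].
rewrite !mem_filter_surj mem_filter mem_index_iota.
move=> /andP[/eqP bE /andP[j1 jn]] /and3P[/eqP su pu /eqP szu] /and3P[/eqP sv pv /eqP szv].
set l := lowcut s j in su; set h := highcut s j in sv.
(* The word sought is [map g s]. A letter of [s] at most [j] is replaced by the letter of [u] at its
   place in the lower half; any other by the letter of [v] at its place in the upper half, raised
   above those of [u]. The level of the cut is then [maxl u]. *)
set g := fun y => if y <= j then nth 0 u (index y l) else maxl u + nth 0 v (index y h).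
have sl : size l = size u by rewrite /l size_lowcut_perm ?szu // ltnW.
have sh : size h = size v.
  by have := size_lowcut_highcut j ps; rewrite -/l -/h sl szu szv -/n => <-; rewrite addKn.
have gl : map g l = u.
  have ul : uniq l by rewrite filter_uniq.
  apply: (@eq_from_nth _ 0) => [|k]; rewrite size_map ?sl // => lk.
  rewrite (nth_map 0) ?sl // /g index_uniq ?sl // ifT //.
  have := mem_nth 0 (_ : k < size l); rewrite sl /l lowcutE // => /(_ lk).
  by rewrite mem_filter => /andP[].
have gh : map g h = map (addn (maxl u)) v.
  have ul : uniq h by rewrite filter_uniq.
  apply: (@eq_from_nth _ 0) => [|k]; rewrite !size_map ?sh // => lk.
  rewrite !(nth_map 0) ?sh // /g index_uniq ?sh // ifN //.
  have := mem_nth 0 (_ : k < size h); rewrite sh /h highcutE // => /(_ lk).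
  by rewrite mem_filter => /andP[].
have gt y : y \in s -> (g y <= maxl u) = (y <= j).
  move=> ys; have [yj|yj] := leqP y j.
    have : g y \in u by rewrite -gl map_f // /l lowcutE // mem_filter yj.
    by rewrite (mem_packed pu) mem_iota add1n ltnS => /andP[_ ->].
  have : g y \in map (addn (maxl u)) v.
    by rewrite -gh map_f // /h highcutE // mem_filter -ltnNge yj.
  case/mapP=> x xv ->; apply/negbTE; rewrite -ltnNge -[X in X < _]addn0 ltn_add2l.
  exact: packed_gt0 pv xv.
have wl : [seq x <- map g s | x <= maxl u] = u.
  by rewrite filter_map -[RHS]gl /l lowcutE //; congr map; exact: eq_in_filter.
have wh : [seq x <- map g s | ~~ (x <= maxl u)] = map (addn (maxl u)) v.
  rewrite filter_map -[RHS]gh /h highcutE //; congr map.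
  by apply: eq_in_filter => y /gt /= ->.
have [pw mw] : packed (map g s) /\ maxl (map g s) = maxl u + maxl v.
  apply: packed_mem => x; rewrite -(mem_catshift pu pv) /catshift -wh -[X in X ++ _]wl.
  by rewrite (perm_mem (permEl (perm_filterC _ _))).
have u0 : packed_word u by rewrite /packed_word /= pu andbT -size_eq0 szu -lt0n.
have v0 : packed_word v by rewrite /packed_word /= pv andbT -size_eq0 szv -lt0n subn_gt0.
have vm := packed_word_max v0; have um := packed_word_max u0.
have El : lowcut (map g s) (maxl u) = u by rewrite lowcutE.
have Eh : pack (highcut (map g s) (maxl u)) = v.
  rewrite highcutE // wh pack_map ?pack_packed // => x y _ _; exact: leq_add2l.
apply/allpairsPdep; exists (map g s), (maxl u); split; last by rewrite El Eh.
  rewrite mem_filter_surj pw size_map eqxx !andbT -std_relEq //.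
  rewrite /std_rel size_map eqxx /= -[X in zip _ X]map_id zip_map pairwise_map.
  have P l' : std_rel (map g l') l' -> pairwise (relpre (fun y => (g y, y)) std_pair) l'.
    by case/andP=> _; rewrite -[X in zip _ X]map_id zip_map pairwise_map.
  (* Within each half the relation is the hypothesis on [u] or on [v]; between the halves it follows
     from the thresholds. *)
  apply: (@pairwise_split _ _ (leq^~ j)).
  - rewrite -lowcutE //; apply: P; rewrite -/l gl std_relEq ?su //.
    by rewrite is_permE filter_uniq // andbT (lowcut_packed ps _).1 // ms ltnW.
  - rewrite -highcutE //; apply: P; rewrite -/h gh.
    rewrite -[X in std_rel _ X]map_id std_rel_map // => [|x y _ _]; last exact: leq_add2l.
    rewrite -std_rel_packr std_relEq ?sv //.
    by rewrite is_permE packed_pack uniq_pack filter_uniq.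
  by move=> x y /gt gx /gt gy; exact: (@threshold_std_pair _ _ (g x, x) (g y, y) gx gy).
rewrite mem_filter mem_index_iota mw um /= -ltn_subLR ?subnn // vm andbT -bE.
by case: (s) n0 gt => //= y s' _ gt; rewrite /letter /= gt ?mem_head.
Qed.

Lemma perm_cut b : perm_eq (cut_left b) (cut_right b).
Proof.
apply: uniq_perm; [exact: cut_left_uniq | exact: cut_right_uniq |].
by move=> p; apply/idP/idP; [exact: cut_left_right | exact: cut_right_left].
Qed.

End CutPerm.

(** * Linear extensions *)

Local Open Scope ring_scope.

Section Linear.
Context (k : fieldType).

Lemma lin_sum (U V : lmodType k) (f : U -> V) : linear f ->
  forall (I : Type) (r : seq I) (P : pred I) (F : I -> U),
  f (\sum_(i <- r | P i) F i) = \sum_(i <- r | P i) f (F i).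
Proof.
move=> lf I r P F; have f0 : f 0 = 0.
  by have := lf (-1) 0 0; rewrite scaleN1r oppr0 addr0 scaleN1r addNr.
have fD x y : f (x + y) = f x + f y by have := lf 1 x y; rewrite !scale1r.
exact: (big_morph f fD f0).
Qed.

Lemma fglift_linear (K : choiceType) (M : lmodType k) (f : K -> M) :
  linear (fglift f : {freeg K / k} -> M).
Proof.
have fB : additive (fglift f : {freeg K / k} -> M) by exact: lift_is_additive.
have f0 : fglift f 0 = 0 :> M by rewrite -(subrr 0) fB subrr.
have fD x y : fglift f (x + y) = fglift f x + fglift f y :> M.
  by rewrite -[in LHS](opprK y) fB -(sub0r y) fB f0 sub0r opprK.
move=> a x y; rewrite fD; congr (_ + _).
have fs := big_morph _ fD f0.
rewrite -[x in RHS]freeg_sumE fs fs scaler_sumr.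
by apply: eq_bigr => z _; rewrite !liftU scalerA.
Qed.

Lemma freegUZ (K : choiceType) (a : k) (x : K) :
  << a *g x >> = a *: << x >> :> {freeg K / k}.
Proof. by apply/eqP/freeg_eqP => z; rewrite coeffZ !coeffU mul1r. Qed.

Lemma freeg_linear_ext (K : choiceType) (M : lmodType k) (f g : {freeg K / k} -> M) :
  linear f -> linear g -> (forall x, f << x >> = g << x >>) -> f =1 g.
Proof.
move=> lf lg E D; rewrite -(freeg_sumE D) !lin_sum //; apply: eq_bigr => z _.
have Z h : linear h -> h (<< coeff z D *g z >>) = coeff z D *: h << z >> :> M.
  move=> lh; rewrite freegUZ; have := lh (coeff z D) << z >> 0.
  rewrite addr0 => ->; have := lin_sum lh [::] xpredT (fun _ : K => 0).
  by rewrite !big_nil => ->; rewrite addr0.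
by rewrite !Z // E.
Qed.

Section Span.
Context (T : choiceType) (P : pred T).
Implicit Type M : lmodType k.

Lemma bvec_sub x (Px : P x) : bvec k P x = << (exist _ x Px : {x | P x}) >>.
Proof. by rewrite /bvec insubT. Qed.

Lemma linext_linear M (f : T -> M) : linear (linext f : span k P -> M).
Proof. exact: fglift_linear. Qed.

Lemma linext_bvec M (f : T -> M) x : P x -> linext f (bvec k P x) = f x.
Proof. by move=> Px; rewrite (bvec_sub Px) /linext liftU scale1r. Qed.

Lemma span_ext M (f g : span k P -> M) : linear f -> linear g ->
  (forall x, P x -> f (bvec k P x) = g (bvec k P x)) -> f =1 g.
Proof.
move=> lf lg E; apply: freeg_linear_ext => // -[x Px].
by rewrite -bvec_sub E.
Qed.

Lemma bilinext_linearl M (f : T -> T -> M) y : linear (fun x : span k P => bilinext f x y).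
Proof. exact: linext_linear. Qed.

(** The definition extends in the first argument last, so linearity in the second is only visible
    once the first is a basis vector; both sides being linear in [x], this suffices. *)
Lemma bilinext_linearr M (f : T -> T -> M) (x : span k P) : linear (bilinext f x).
Proof.
move=> a y z.
apply: (span_ext (f := fun x => bilinext f x (a *: y + z))
                 (g := fun x => a *: bilinext f x y + bilinext f x z) _ _ _ x).
- exact: bilinext_linearl.
- move=> b u v; rewrite !bilinext_linearl !scalerDr !scalerA (mulrC a b).
  by rewrite addrACA.
- by move=> u Pu; rewrite /bilinext !linext_bvec // linext_linear.
Qed.

Lemma bilinext_bvec M (f : T -> T -> M) x y : P x -> P y ->
  bilinext f (bvec k P x) (bvec k P y) = f x y.
Proof. by move=> Px Py; rewrite /bilinext !linext_bvec. Qed.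

Lemma tensor_linearl (y : span k P) : linear (fun x : span k P => tensor x y).
Proof. exact: fglift_linear. Qed.

Lemma tensor_linearr (x : span k P) : linear (tensor x).
Proof.
move=> a y z.
apply: (span_ext (f := fun x => tensor x (a *: y + z))
                 (g := fun x => a *: tensor x y + tensor x z) _ _ _ x).
- exact: tensor_linearl.
- move=> b u v; rewrite !tensor_linearl !scalerDr !scalerA (mulrC a b).
  by rewrite addrACA.
- by move=> u Pu; rewrite (bvec_sub Pu) /tensor !liftU !scale1r fglift_linear.
Qed.

End Span.

Lemma tensor_map_linear (T : choiceType) (P Q : pred T) (f : span k P -> span k Q) :
  linear (tensor_map f).
Proof. exact: fglift_linear. Qed.

Lemma tensor_map_bvec (T : choiceType) (P Q : pred T) (f : span k P -> span k Q) x y :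
  P x -> P y ->
  tensor_map f (tensor (bvec k P x) (bvec k P y)) =
  tensor (f (bvec k P x)) (f (bvec k P y)).
Proof.
move=> Px Py; rewrite !bvec_sub {1}/tensor !liftU !scale1r.
by rewrite /tensor_map liftU scale1r.
Qed.

Lemma tensor_sum (T : choiceType) (P : pred T) (I J : Type) (r : seq I) (r' : seq J)
    (F : I -> span k P) (G : J -> span k P) :
  tensor (\sum_(i <- r) F i) (\sum_(j <- r') G j) =
  \sum_(p <- [seq (i, j) | i <- r, j <- r']) tensor (F p.1) (G p.2).
Proof.
rewrite big_allpairs (lin_sum (tensor_linearl _)); apply: eq_bigr => i _.
exact: (lin_sum (tensor_linearr _)).
Qed.

End Linear.

(** * Compatibility of Psi with the structures *)

(** Each [j] contributes once, at [i = f j]. Taken with [std], packing of a prefix or suffix, and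
    [rho] as [f], it collapses the double sums below. *)
Lemma sum_fiber (M : nmodType) (I J : eqType) (r : seq I) (r' : seq J) (f : J -> I)
    (P : pred I) (Q : pred J) (F : J -> M) : uniq r ->
  \sum_(i <- r | P i) \sum_(j <- r' | Q j && (f j == i)) F j =
  \sum_(j <- r' | [&& Q j, P (f j) & f j \in r]) F j.
Proof.
move=> ur; rewrite (exchange_big_dep Q) /=; last by move=> i j _ /andP[].
rewrite [RHS]big_mkcondr; apply: eq_bigr => j Qj.
rewrite Qj /=; case: ifP => [/andP[Pj jr]|H].
  rewrite big_mkcond (bigD1_seq (f j)) //= Pj eqxx big1 ?addr0 // => i /negPf fi.
  by rewrite eq_sym fi andbF.
rewrite big_seq_cond big1 // => i /andP[ir /andP[Pi /eqP ji]].
by rewrite ji Pi ir in H.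
Qed.

Lemma pack_take_std n w : pack (take n (std w)) = std (take n w).
Proof.
have := std_relE w; rewrite -{1}(cat_take_drop n w) -{1}(cat_take_drop n (std w)).
case/std_rel_cat => [|H _ _]; first by rewrite !size_take_min size_std.
by apply: std_rel_std H; exact/take_uniq/std_uniq.
Qed.

Lemma pack_drop_std n w : pack (drop n (std w)) = std (drop n w).
Proof.
have := std_relE w; rewrite -{1}(cat_take_drop n w) -{1}(cat_take_drop n (std w)).
case/std_rel_cat => [|_ H _]; first by rewrite !size_take_min size_std.
by apply: std_rel_std H; exact/drop_uniq/std_uniq.
Qed.

Section Main.
Context (k : fieldType).
Local Notation qvec := (bvec k packed_word).
Local Notation pvec := (bvec k perm_word).
Local Notation Psi := (@Psi k).

Lemma Psi_linear : linear Psi.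
Proof. exact: linext_linear. Qed.

Lemma Psi_bvec s : perm_word s ->
  Psi (pvec s) = \sum_(w <- surj (size s) | std w == s) qvec w.
Proof.
move=> sP; rewrite /Defs.Psi linext_bvec // big_seq_cond [RHS]big_seq_cond.
apply: eq_bigl => w; rewrite mem_surj; case: eqP => [E|]; last by rewrite andbF.
by rewrite word_leE ?E ?eqxx //; case/andP: sP.
Qed.

(** The fibres of [std] over the permutations partition the packed words of length [N], so a
    condition on permutations becomes the same condition on standardizations. *)
Lemma Psi_sum N (C : pred word) : (0 < N)%N ->
  Psi (\sum_(w <- surj N | is_perm w && C w) pvec w) =
  \sum_(w <- surj N | C (std w)) qvec w.
Proof.
move=> N0; rewrite (lin_sum Psi_linear).
transitivity (\sum_(w <- surj N | is_perm w && C w)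
    \sum_(x <- surj N | xpredT x && (std x == w)) qvec x).
  rewrite big_seq_cond [RHS]big_seq_cond; apply: eq_bigr => w /andP[wN /andP[wP _]].
  have := wN; rewrite mem_surj => /andP[_ /eqP sw].
  by rewrite Psi_bvec ?sw // /perm_word /= wP andbT -size_eq0 sw -lt0n.
rewrite sum_fiber ?surj_uniq // big_seq_cond [RHS]big_seq_cond; apply: eq_bigl => w.
rewrite !mem_surj std_perm size_std /=.
have -> : packed (std w) by have := std_perm w; rewrite is_permE => /andP[].
by case: eqP; rewrite ?andbF //= ?andbT.
Qed.

Lemma sum_shuffle (M : nmodType) u v (P Q : pred word) (F : word -> M) :
    packed_word u -> packed_word v ->
    {in qsh (maxl u) (maxl v), forall z, P z = Q (comp z (catshift u v))} ->
  \sum_(z <- qsh (maxl u) (maxl v) | P z) F (comp z (catshift u v)) =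
  \sum_(w <- surj (size u + size v) |
     [&& pack (take (size u) w) == u, pack (drop (size u) w) == v & Q w]) F w.
Proof.
move=> pu pv PQ; rewrite big_seq_cond.
transitivity (\sum_(z <- qsh (maxl u) (maxl v) | Q (comp z (catshift u v)))
    F (comp z (catshift u v))).
  by rewrite [RHS]big_seq_cond; apply: eq_bigl => z; case zq: (z \in _) => //=; exact: PQ.
rewrite -(big_map (fun z => comp z (catshift u v)) Q F).
rewrite (perm_big _ (perm_shuffle pu pv)) big_filter_cond.
by apply: eq_bigl => w; rewrite andbA.
Qed.

Definition shuffle_sum (D : nat -> pred word) (u v : word) : QSh k :=
  \sum_(w <- surj (size u + size v) |
     [&& pack (take (size u) w) == u, pack (drop (size u) w) == v & D (size u) w]) qvec w.

Lemma preceq_bvec u v : packed_word u -> packed_word v ->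
  preceq_QSh (qvec u) (qvec v) = shuffle_sum (fun n w => 1%N \in take n w) u v.
Proof.
move=> pu pv; rewrite /preceq_QSh /prec_QSh /bullet_QSh !bilinext_bvec //.
have m0 := packed_word_max pu.
rewrite /shuffle_sum -(@sum_shuffle _ _ _ (fun z => letter z 1 == 1%N)) //; last first.
  by move=> z zq; rewrite mem1_take_comp.
(* Among the quasi-shuffles with value 1 at the first position, [bullet] takes those that also have
   value 1 at the start of the second half, and [prec] the others. *)
rewrite [RHS](bigID (fun z => letter z (maxl u).+1 == 1%N)) addrC /=; congr (_ + _);
  rewrite big_seq_cond [RHS]big_seq_cond; apply: eq_bigl => z; case zq: (z \in _) => //=;
  rewrite (preim1E pu pv zq);
  case: (letter z 1 == 1%N); case: (letter z (maxl u).+1 == 1%N) => //=;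
  by rewrite ?eqseq_cons ?eqxx /= ?andbF ?eqSS ?(gtn_eqF m0).
Qed.

Lemma succ_bvec u v : packed_word u -> packed_word v ->
  succ_QSh (qvec u) (qvec v) = shuffle_sum (fun n w => 1%N \notin take n w) u v.
Proof.
move=> pu pv; rewrite /succ_QSh bilinext_bvec // /shuffle_sum.
rewrite -(@sum_shuffle _ _ _ (fun z => preim1 z == [:: (maxl u).+1])) // => z zq.
have := mem1_comp pu pv zq; have m0 := packed_word_max pu.
rewrite (mem1_take_comp pu pv zq) (preim1E pu pv zq).
case: (letter z 1 == 1%N); case: (letter z (maxl u).+1 == 1%N) => //= _.
- by rewrite !eqseq_cons andbF.
- by rewrite eqseq_cons; case: (maxl u) m0.
- by rewrite eqxx.
Qed.

Lemma Psi_shuffle_sum (op : QSh k -> QSh k -> QSh k) (D : nat -> pred word) s t :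
    (forall y, linear (op^~ y)) -> (forall x, linear (op x)) ->
    (forall u v, packed_word u -> packed_word v ->
       op (qvec u) (qvec v) = shuffle_sum D u v) ->
    perm_word s -> perm_word t ->
  op (Psi (pvec s)) (Psi (pvec t)) =
  \sum_(w <- surj (size s + size t) |
     [&& std (take (size s) w) == s, std (drop (size s) w) == t & D (size s) w]) qvec w.
Proof.
move=> opl opr opE sP tP; rewrite !Psi_bvec // (lin_sum (opl _)).
have [s0 t0] : (0 < size s)%N /\ (0 < size t)%N.
  by case/andP: sP => + _; case/andP: tP => + _; rewrite -!size_eq0 -!lt0n.
pose N := (size s + size t)%N.
(* Each [w] occurs for one [u] and one [v] only, its packed prefix and suffix. The sums over [v] and
   then [u] collapse, and [std_pack] turns their conditions into conditions on the prefix and suffix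
   of [w]. *)
transitivity (\sum_(u <- surj (size s) | std u == s)
  \sum_(v <- surj (size t) | std v == t)
   \sum_(w <- surj N | ((pack (take (size s) w) == u) && D (size s) w) &&
                    (pack (drop (size s) w) == v)) qvec w).
  rewrite big_seq_cond [RHS]big_seq_cond; apply: eq_bigr => u /andP[us _].
  rewrite (lin_sum (opr _)) big_seq_cond [RHS]big_seq_cond; apply: eq_bigr => v /andP[vs _].
  rewrite opE ?(surj_packed_word _ us) ?(surj_packed_word _ vs) //.
  move: us vs; rewrite !mem_surj /shuffle_sum => /andP[_ /eqP->] /andP[_ /eqP->].
  by apply: eq_bigl => w; rewrite [RHS]andbAC -!andbA.
have H w : w \in surj N ->
    (pack (take (size s) w) \in surj (size s)) * (pack (drop (size s) w) \in surj (size t)).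
  rewrite !mem_surj !packed_pack !size_pack => /andP[_ /eqP sw].
  by rewrite size_take_min size_drop sw /N (minn_idPl (leq_addr _ _)) addKn !eqxx.
transitivity (\sum_(u <- surj (size s) | std u == s) \sum_(w <- surj N |
    (D (size s) w && (std (drop (size s) w) == t)) &&
    (pack (take (size s) w) == u)) qvec w).
  apply: eq_bigr => u _; rewrite sum_fiber ?surj_uniq // big_seq_cond [RHS]big_seq_cond.
  apply: eq_bigl => w; case wN: (w \in _) => //=; rewrite (H _ wN) std_pack andbT.
  by rewrite -!andbA andbC -andbA.
rewrite sum_fiber ?surj_uniq // big_seq_cond [RHS]big_seq_cond.
apply: eq_bigl => w; case wN: (w \in _) => //=; rewrite (H _ wN) std_pack andbT.
by rewrite andbC; congr (_ && _); exact: andbC.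
Qed.

Lemma bilin_morph (opP : Sh k -> Sh k -> Sh k) (opQ : QSh k -> QSh k -> QSh k) :
    (forall y, linear (opP^~ y)) -> (forall x, linear (opP x)) ->
    (forall y, linear (opQ^~ y)) -> (forall x, linear (opQ x)) ->
    (forall s t, perm_word s -> perm_word t ->
       Psi (opP (pvec s) (pvec t)) = opQ (Psi (pvec s)) (Psi (pvec t))) ->
  forall x y, Psi (opP x y) = opQ (Psi x) (Psi y).
Proof.
move=> Pl Pr Ql Qr E x y; move: x.
apply: (span_ext (f := fun x => Psi (opP x y)) (g := fun x => opQ (Psi x) (Psi y))).
- by move=> a u v; rewrite Pl Psi_linear.
- by move=> a u v; rewrite Psi_linear Ql.
move=> s sP; move: y.
apply: (span_ext (f := fun y => Psi (opP _ y)) (g := fun y => opQ _ (Psi y))).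
- by move=> a u v; rewrite Pr Psi_linear.
- by move=> a u v; rewrite Psi_linear Qr.
by move=> t tP; exact: E.
Qed.

(** [b] is true for [prec] and false for [succ]. Every condition on the shuffled permutation is one
    on [std w] that can be read on [w] itself, which gives the same sum as [Psi_shuffle_sum]. *)
Lemma Psi_perm_shuffle (b : bool) s t (P : pred word) : perm_word s -> perm_word t ->
    {in qsh (maxl s) (maxl t), forall z, is_perm z ->
       P z = ((1%N \in take (size s) (comp z (catshift s t))) == b)} ->
  Psi (\sum_(z <- qsh (maxl s) (maxl t) | is_perm z && P z) pvec (comp z (catshift s t))) =
  \sum_(w <- surj (size s + size t) |
     [&& std (take (size s) w) == s, std (drop (size s) w) == t &
         (1%N \in take (size s) w) == b]) qvec w.
Proof.
move=> sP tP PE; have [ps pt] := (perm_word_packed sP, perm_word_packed tP).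
have N0 : (0 < size s + size t)%N.
  by case/andP: sP => + _; rewrite -size_eq0 -lt0n => s0; rewrite addn_gt0 s0.
pose Q w := is_perm w && ((1%N \in take (size s) w) == b).
rewrite (@sum_shuffle _ _ _ _ Q) //; last first.
  move=> z zq; rewrite /Q is_perm_comp //; try by [case/andP: sP | case/andP: tP].
  by case zP: (is_perm z) => //=; rewrite PE.
pose C w := [&& pack (take (size s) w) == s, pack (drop (size s) w) == t &
                (1%N \in take (size s) w) == b].
rewrite (eq_bigl (fun w => is_perm w && C w)); last first.
  by move=> w; rewrite /Q /C; case: (is_perm w); rewrite ?andbF.
rewrite Psi_sum // big_seq_cond [RHS]big_seq_cond; apply: eq_bigl => w.
rewrite mem_surj; case pw: (packed w) => //=.
by rewrite /C pack_take_std pack_drop_std mem1_take_std.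
Qed.

Lemma Psi_prec x y : Psi (prec_Sh x y) = preceq_QSh (Psi x) (Psi y).
Proof.
move: x y; apply: bilin_morph.
- by move=> y; exact: bilinext_linearl.
- by move=> x; exact: bilinext_linearr.
- move=> y a u v; rewrite /preceq_QSh /prec_QSh /bullet_QSh !bilinext_linearl.
  by rewrite scalerDr addrACA.
- move=> x a u v; rewrite /preceq_QSh /prec_QSh /bullet_QSh !bilinext_linearr.
  by rewrite scalerDr addrACA.
move=> s t sP tP; rewrite (Psi_shuffle_sum _ _ preceq_bvec) //.
- rewrite /prec_Sh bilinext_bvec // (@Psi_perm_shuffle true) //.
    by apply: eq_bigl => w; rewrite eqb_id.
  by move=> z zq _; rewrite mem1_take_comp ?perm_word_packed // eqb_id.
- move=> y a u v; rewrite /preceq_QSh /prec_QSh /bullet_QSh !bilinext_linearl.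
  by rewrite scalerDr addrACA.
- move=> x a u v; rewrite /preceq_QSh /prec_QSh /bullet_QSh !bilinext_linearr.
  by rewrite scalerDr addrACA.
Qed.

Lemma Psi_succ x y : Psi (succ_Sh x y) = succ_QSh (Psi x) (Psi y).
Proof.
move: x y; apply: bilin_morph;
  try by move=> ?; solve [exact: bilinext_linearl | exact: bilinext_linearr].
move=> s t sP tP; rewrite (Psi_shuffle_sum _ _ succ_bvec) //;
  try by move=> ?; solve [exact: bilinext_linearl | exact: bilinext_linearr].
rewrite /succ_Sh bilinext_bvec // (@Psi_perm_shuffle false) //.
  by apply: eq_bigl => w; rewrite eqbF_neg.
(* A permutation cannot take the value 1 at the start of both halves, so a [1] opening the second
   half excludes one in the prefix. *)
move=> z zq; rewrite is_permE => /andP[_ uz].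
have [ps pt] := (perm_word_packed sP, perm_word_packed tP).
have := mem1_comp ps pt zq; have [_ sz _ _] := qshP _ _ _ zq.
rewrite mem1_take_comp // eqbF_neg; case: eqP => [E|//]; case: eqP => // E'.
have m0 := packed_word_max ps; have m1 := packed_word_max pt.
have : nth 0%N z 0 == nth 0%N z (maxl s) by rewrite -[nth _ _ 0]/(letter z 1) E -E'.
rewrite nth_uniq //; first by move/eqP => E0; rewrite -E0 in m0.
- by rewrite sz addn_gt0 m0.
- by rewrite sz -[X in (X < _)%N]addn0 ltn_add2l.
Qed.

(** The two half-coproducts divide the levels according to whether they reach the first letter, so
    one boolean covers both. *)
Lemma big_cut_range (M : nmodType) (b : bool) (a m : nat) (F : nat -> M) :
  (0 < a <= m)%N ->
  \sum_(i <- [seq i <- index_iota 1 m | (a <= i)%N == b]) F i =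
  if b then \sum_(a <= i < m) F i else \sum_(1 <= i < a) F i.
Proof.
case/andP=> a0 am; rewrite big_filter; case: b.
  by rewrite (big_nat_widenl _ _ _ _ _ a0); apply: eq_bigl => i; rewrite eqb_id.
by rewrite (big_nat_widen _ _ _ _ _ am); apply: eq_bigl => i; rewrite eqbF_neg -ltnNge.
Qed.

Definition Delta (b : bool) (P : pred word) : span k P -> span2 k P :=
  if b then Delta_prec k P else Delta_succ k P.

Lemma Delta_linear b P : linear (Delta b (P := P)).
Proof. by case: b; exact: linext_linear. Qed.

Lemma Delta_bvec b (P : pred word) w : P w -> packed_word w ->
  Delta b (bvec k P w) =
  \sum_(i <- [seq i <- index_iota 1 (maxl w) | (letter w 1 <= i)%N == b]) cut k P w i.
Proof.
move=> Pw pw; rewrite big_cut_range; last first.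
  case/andP: pw; case: w {Pw} => // x w _ pw; have xw := mem_head x w.
  rewrite (packed_gt0 pw xw) /letter /=.
  by move: xw; rewrite (mem_packed pw) mem_iota add1n ltnS => /andP[].
by case: b; rewrite /Delta ?/Delta_prec ?/Delta_succ linext_bvec.
Qed.

Lemma Psi_Delta b x : Delta b (Psi x) = tensor_map Psi (Delta b x).
Proof.
move: x; apply: (span_ext (f := fun x => Delta b (Psi x))
  (g := fun x => tensor_map Psi (Delta b x))).
- by move=> a u v; rewrite Psi_linear Delta_linear.
- by move=> a u v; rewrite Delta_linear tensor_map_linear.
move=> s sP; have s0 : (0 < size s)%N by case/andP: sP => + _; rewrite -size_eq0 -lt0n.
have ms : maxl s = size s by apply: is_perm_maxl; case/andP: sP.
transitivity (\sum_(p <- cut_left s b) tensor (qvec p.1) (qvec p.2)).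
  rewrite Psi_bvec // (lin_sum (@Delta_linear b _)) big_allpairs_dep big_filter.
  rewrite big_seq_cond [RHS]big_seq_cond; apply: eq_bigr => w /andP[ws _].
  have pw := surj_packed_word s0 ws.
  by rewrite Delta_bvec.
rewrite (perm_big _ (perm_cut sP b)) Delta_bvec ?perm_word_packed //.
rewrite (lin_sum (tensor_map_linear _)) big_allpairs_dep ms.
rewrite big_seq_cond [RHS]big_seq_cond; apply: eq_bigr => j.
rewrite andbT mem_filter mem_index_iota => /andP[_ /andP[j0 jn]].
have jb : (0 < j < maxl s)%N by rewrite j0 ms.
have [lP hP] := perm_word_cut sP jb.
rewrite /cut tensor_map_bvec // !Psi_bvec // size_pack.
have sl : size (restr s (index_iota 1 j.+1)) = j by rewrite (size_lowcut_perm sP) // ltnW.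
have sh : size (restr s (index_iota j.+1 (maxl s).+1)) = (size s - j)%N.
  have ps : packed s by case/andP: (perm_word_packed sP).
  by rewrite -(size_lowcut_highcut j ps) /lowcut sl addKn.
rewrite sl sh -[X in tensor X _]big_filter -[X in tensor _ X]big_filter.
by rewrite (tensor_sum _ _ qvec qvec).
Qed.

(** Both sides are the sum of the packed words [w] with [rho (std w) = t]: on the right, [rho w]
    lies below [t] exactly when its binarization is [t]. *)
Lemma Psi_Omega (t : PBT k) : Psi (Omega' t) = Omega (psi t).
Proof.
move: t; apply: (span_ext (f := fun t => Psi (Omega' t)) (g := fun t => Omega (psi t))).
- by move=> a u v; rewrite /Omega' linext_linear Psi_linear.
- by move=> a u v; rewrite /Omega /psi !linext_linear.
move=> t tB; have := tB => /andP[bt d0].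
rewrite /Omega' /psi !linext_bvec // Psi_sum // /Omega (lin_sum (@linext_linear _ _ _ _ _)).
transitivity (\sum_(t' <- below t | xpredT t')
    \sum_(w <- surj (degree t) | xpredT w && (rho w == t')) qvec w); last first.
  rewrite big_seq_cond [RHS]big_seq_cond; apply: eq_bigr => t' /andP[tb _].
  rewrite linext_bvec; last exact: below_schroder_tree tb.
  by have [_ ->] := below_schroder (binary_schroder bt) tb.
rewrite sum_fiber ?undup_uniq // big_seq_cond [RHS]big_seq_cond; apply: eq_bigl => w.
rewrite mem_surj; case pw: (packed w) => //=.
by rewrite mem_below ?schroder_rho // rho_std.
Qed.

End Main.

Theorem proposition52 (k : fieldType) :
  bidendriform_morphism
    (@prec_Sh k) (@succ_Sh k)
    (Delta_prec k perm_word) (Delta_succ k perm_word)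
    (@preceq_QSh k) (@succ_QSh k)
    (Delta_prec k packed_word) (Delta_succ k packed_word)
    (@Psi k) /\
  (forall t : PBT k, Psi (Omega' t) = Omega (psi t)).
Proof.
split; last exact: Psi_Omega.
split; [exact: Psi_linear | exact: Psi_prec | exact: Psi_succ | |].
- exact: (Psi_Delta true).
- exact: (Psi_Delta false).
Qed.
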